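(* Let $K$ be an algebraically closed field of arbitrary characteristic, and let $N$, $d$ and $n$ be integers such that $N\ge 2$, $(N,d,n)\ne(2,2,5)$, and $N+1\le n\le\binom{d+N}{N}$. Then there is a family of $n$ monomials in $K[X_0,\ldots,X_N]$ of degree $d$ such that their syzygy bundle on $\mathbb{P}^N$ is stable. For $(N,d,n)=(2,2,5)$, there are $5$ monomials of degree $2$ in $K[X_0,X_1,X_2]$ such that their syzygy bundle on $\mathbb{P}^2$ is semistable.
   Context: $\mathbb{P}^N$ is projective $N$-space over $K$ and $\mathcal{O}=\mathcal{O}_{\mathbb{P}^N}$. Degrees $d$ are positive integers. A family of $n$ monomials means $n$ distinct monic monomials. Syzygy bundle: if $f_1,\ldots,f_n\in K[X_0,\ldots,X_N]$ are homogeneous of degree $d$ and the ideal $(f_1,\ldots,f_n)$ is $\mathfrak{m}$-primary, where $\mathfrak{m}=(X_0,\ldots,X_N)$, then the syzygy bundle $\mathrm{Syz}(f_1,\ldots,f_n)$ is the kernel of the morphism $\mathcal{O}(-d)^n\to\mathcal{O}$, $(g_1,\ldots,g_n)\mapsto f_1g_1+\cdots+f_ng_n$; it is a vector bundle of rank $n-1$. Saying that a family has a (stable, semistable) syzygy bundle includes the requirement that the ideal it generates is $\mathfrak{m}$-primary. Stability: for a torsion-free coherent sheaf $E$ on $\mathbb{P}^N$ of rank $r>0$, the slope is $\mu(E)=c_1(E)/r$. $E$ is semistable (in the sense of Mumford–Takemoto) if $\mu(F)\le\mu(E)$ for every coherent subsheaf $F\subset E$ with $0<\mathrm{rk}\,F<\mathrm{rk}\,E$,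 and stable if the inequality is always strict. *)

(* Defs.v *)
From HB Require Import structures.
From mathcomp Require Import all_boot all_order all_algebra.
From mathcomp Require Import mpoly.

Set Implicit Arguments.
Unset Strict Implicit.
Unset Printing Implicit Defensive.

Import Order.TTheory GRing.Theory Num.Theory.
Local Open Scope ring_scope.

Section Ideals.
Variables (K : fieldType) (N : nat).
Local Notation S := {mpoly K[N.+1]}.

Definition ideal_gen (n : nat) (f : 'I_n -> S) (p : S) : Prop :=
  exists g : 'I_n -> S, p = \sum_(j < n) f j * g j.

Definition radical (I : S -> Prop) (p : S) : Prop :=
  exists k : nat, I (p ^+ k).

Definition primary (I : S -> Prop) : Prop :=
  ~ I 1 /\ (forall p q : S, I (p * q) -> I p \/ radical I q).

Definition irrelevant : S -> Prop := ideal_gen (fun i : 'I_N.+1 => 'X_i).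

Definition m_primary (I : S -> Prop) : Prop :=
  primary I /\ (forall p : S, radical I p <-> irrelevant p).

End Ideals.

(* Sheaves on P^N are encoded as coherent subsheaves of O(a)^n, inside the
   field Frac = K(X_0, ..., X_N).  On the standard chart U_i = D_+(X_i), the
   sections of O(a) are the fractions p / X_i^m with p homogeneous of degree
   m + a; for a = 0 this is the coordinate ring of U_i.
   A quasi-coherent subsheaf of O(a)^n is given by one O(U_i)-submodule of
   O(a)(U_i)^n for each i, such that the submodules for i and j have the same
   localization on U_i :&: U_j.  As P^N is noetherian, such a subsheaf is
   automatically coherent, so finite generation is not imposed.  All these
   sheaves are torsion-free. *)

Section Sheaves.
Variables (K : fieldType) (N : nat).
Local Notation S := {mpoly K[N.+1]}.
Local Notation Frac := {fraction {mpoly K[N.+1]}}.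

Definition var (i : 'I_N.+1) : Frac := tofrac ('X_i : S).

Definition twist (a : int) (i : 'I_N.+1) (s : Frac) : Prop :=
  exists (m l : nat) (p : S),
    [/\ p \is l.-homog, l%:Z = m%:Z + a & s = tofrac p / var i ^+ m].

(* [sections_glue], used for (i, j) and for (j, i), says that the two
   localizations on U_i :&: U_j coincide. *)
Record subsheaf (a : int) (n : nat) := Subsheaf {
  sections :> 'I_N.+1 -> 'rV[Frac]_n -> Prop;
  sections_twist : forall i v, sections i v -> forall k, twist a i (v 0 k);
  sections_0 : forall i, sections i 0;
  sections_D : forall i u v,
    sections i u -> sections i v -> sections i (u + v);
  sections_Z : forall i s v,
    twist 0 i s -> sections i v -> sections i (s *: v);
  sections_glue : forall i j v, sections i v ->
    exists m : nat, sections j ((var i / var j) ^+ m *: v)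
}.

Definition subsheaf_of (a : int) (n : nat) (F E : subsheaf a n) : Prop :=
  forall i v, F i v -> E i v.

(* The rows of B form a basis of the stalk of F at the generic point (U_0 is
   dense).  Since the entries of these vectors are homogeneous of degree a,
   independence and span over Frac amount to independence and span over the
   function field of P^N, the degree-0 part of Frac. *)
Definition generic_basis (a : int) (n r : nat) (F : subsheaf a n)
    (B : 'M[Frac]_(r, n)) : Prop :=
  [/\ row_free B, forall k, F ord0 (row k B)
    & forall v, F ord0 v -> (v <= B)%MS].

Definition has_rank (a : int) (n : nat) (F : subsheaf a n) (r : nat) : Prop :=
  exists B : 'M[Frac]_(r, n), generic_basis F B.

(* A generic basis B trivializes the generic stalk of /\^r F, and identifies
   (/\^r F)(U_i) modulo torsion with the fractional ideal generated by the
   \det C such that the rows of C *m B are sections of F on U_i.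
   [ext_dual] is its dual (/\^r F)^*, and [det_sheaf] is the bidual
   det F = (/\^r F)^**. *)
Definition ext_dual (a : int) (n r : nat) (F : subsheaf a n)
    (B : 'M[Frac]_(r, n)) (i : 'I_N.+1) (h : Frac) : Prop :=
  forall C : 'M[Frac]_r,
    (forall k, F i (row k (C *m B))) -> twist 0 i (h * \det C).

Definition det_sheaf (a : int) (n r : nat) (F : subsheaf a n)
    (B : 'M[Frac]_(r, n)) (i : 'I_N.+1) (g : Frac) : Prop :=
  forall h : Frac, ext_dual F B i h -> twist 0 i (g * h).

(* c_1(F) = c_1(det F), i.e. the integer c such that det F is isomorphic to
   O(c).  An isomorphism O(c) -> det F is multiplication by a nonzero w, which
   is then homogeneous of degree - c.  The integer c exists (a reflexive sheaf
   of rank 1 on P^N is a line bundle) and is unique for N > 0. *)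
Definition has_c1 (a : int) (n : nat) (F : subsheaf a n) (c : int) : Prop :=
  exists (r : nat) (B : 'M[Frac]_(r, n)) (w : Frac),
    [/\ generic_basis F B, w != 0
      & forall i g, det_sheaf F B i g <-> twist c i (g / w)].

Definition has_slope (a : int) (n : nat) (F : subsheaf a n) (mu : rat) : Prop :=
  exists (r : nat) (c : int),
    [/\ (0 < r)%N, has_rank F r, has_c1 F c & mu = c%:~R / r%:R].

Definition semistable (a : int) (n : nat) (E : subsheaf a n) : Prop :=
  exists (rE : nat) (muE : rat),
    [/\ has_rank E rE, has_slope E muE
      & forall (F : subsheaf a n) (rF : nat) (muF : rat),
          subsheaf_of F E -> has_rank F rF -> (0 < rF < rE)%N ->
          has_slope F muF -> muF <= muE].

Definition stable (a : int) (n : nat) (E : subsheaf a n) : Prop :=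
  exists (rE : nat) (muE : rat),
    [/\ has_rank E rE, has_slope E muE
      & forall (F : subsheaf a n) (rF : nat) (muF : rat),
          subsheaf_of F E -> has_rank F rF -> (0 < rF < rE)%N ->
          has_slope F muF -> muF < muE].

Lemma var_neq0 i : var i != 0.
Proof. by rewrite tofrac_eq0 -msize_poly_eq0 msizeX. Qed.

Lemma twist_raise a i s : twist a i s -> exists m0 : nat,
  forall m : nat, (m0 <= m)%N -> exists (l : nat) (p : S),
    [/\ p \is l.-homog, l%:Z = m%:Z + a & s = tofrac p / var i ^+ m].
Proof.
case=> m0 [l0 [p [hp hl ->]]]; exists m0 => m le_m.
exists (l0 + (m - m0))%N, (p * 'X_i ^+ (m - m0)); split.
- have hX : ('X_i : S) \is 1.-homog by rewrite dhomogX /= mdeg1.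
  by apply: dhomogM => //; have := dhomogMn (m - m0) hX; rewrite mul1n.
- by rewrite PoszD hl addrAC -PoszD subnKC.
rewrite tofracM tofracXn -/(var i) -{2}(subnK le_m) exprD invfM.
by rewrite mulrA mulfK // expf_neq0 // var_neq0.
Qed.

Lemma twist_0 a i : twist a i 0.
Proof.
exists (absz a), (absz ((absz a)%:Z + a)), 0; split; first exact: dhomog0.
  by rewrite gez0_abs // abszE -lerBlDr sub0r -normrN ler_norm.
by rewrite tofrac0 mul0r.
Qed.

Lemma twist_D a i s t : twist a i s -> twist a i t -> twist a i (s + t).
Proof.
move=> /twist_raise[m1 h1] /twist_raise[m2 h2].
have [l1 [p1 [hp1 hl1 ->]]] := h1 _ (leq_maxl m1 m2).
have [l2 [p2 [hp2 hl2 ->]]] := h2 _ (leq_maxr m1 m2).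
have e : l1 = l2 by apply/eqP; rewrite -eqz_nat hl1 hl2.
subst l2; exists (maxn m1 m2), l1, (p1 + p2); split=> //.
  exact: dhomogD.
by rewrite tofracD mulrDl.
Qed.

Lemma twist_M a b i s t : twist a i s -> twist b i t -> twist (a + b) i (s * t).
Proof.
move=> [m1 [l1 [p1 [hp1 hl1 ->]]]] [m2 [l2 [p2 [hp2 hl2 ->]]]].
exists (m1 + m2)%N, (l1 + l2)%N, (p1 * p2); split.
- exact: dhomogM.
- by rewrite !PoszD hl1 hl2 addrACA.
by rewrite tofracM exprD invfM mulrACA.
Qed.

Lemma twist_glue a i j s : twist a i s -> exists m0 : nat,
  forall m : nat, (m0 <= m)%N -> twist a j ((var i / var j) ^+ m * s).
Proof.
move=> /twist_raise[m0 h]; exists m0 => m /h [l [p [hp hl ->]]].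
exists m, l, p; split=> //.
by rewrite expr_div_n mulrC mulrA divfK // expf_neq0 // var_neq0.
Qed.

Section Syz.
Variables (d n : nat) (f : 'I_n -> S).

(* The kernel of O(-d)^n -> O, (g_1, ..., g_n) |-> f_1 g_1 + ... + f_n g_n,
   for f_1, ..., f_n homogeneous of degree d. *)
Definition syz_sections (i : 'I_N.+1) (v : 'rV[Frac]_n) : Prop :=
  (forall k, twist (- d%:Z) i (v 0 k)) /\
  \sum_(k < n) tofrac (f k) * v 0 k = 0.

Lemma syz_twist i v : syz_sections i v -> forall k, twist (- d%:Z) i (v 0 k).
Proof. by case. Qed.

Lemma syz_0 i : syz_sections i 0.
Proof.
split=> [k|]; first by rewrite mxE; apply: twist_0.
by apply: big1 => k _; rewrite mxE mulr0.
Qed.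

Lemma syz_D i u v : syz_sections i u -> syz_sections i v -> syz_sections i (u + v).
Proof.
move=> [hu eu] [hv ev]; split=> [k|]; first by rewrite mxE; apply: twist_D.
under eq_bigr do rewrite mxE mulrDr.
by rewrite big_split /= eu ev addr0.
Qed.

Lemma syz_sumZ (s : Frac) (v : 'rV_n) : \sum_(k < n) tofrac (f k) * v 0 k = 0 ->
  \sum_(k < n) tofrac (f k) * (s *: v) 0 k = 0.
Proof.
move=> e; under eq_bigr do rewrite mxE mulrCA.
by rewrite -mulr_sumr e mulr0.
Qed.

Lemma syz_Z i s v : twist 0 i s -> syz_sections i v -> syz_sections i (s *: v).
Proof.
move=> hs [hv ev]; split=> [k|]; last exact: syz_sumZ.
by rewrite mxE -[- _]add0r; apply: twist_M.
Qed.

Lemma syz_glue i j v : syz_sections i v ->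
  exists m : nat, syz_sections j ((var i / var j) ^+ m *: v).
Proof.
move=> [hv ev].
have [m0 hm0] : exists m0 : 'I_n -> nat, forall k, forall m, (m0 k <= m)%N ->
    twist (- d%:Z) j ((var i / var j) ^+ m * v 0 k).
  exact: (fin_all_exists (fun k => twist_glue j (hv k))).
exists (\max_k m0 k)%N; split; last exact: syz_sumZ.
by move=> k; rewrite mxE; apply: hm0; apply: leq_bigmax.
Qed.

Definition Syz : subsheaf (- d%:Z) n :=
  Subsheaf syz_twist syz_0 syz_D syz_Z syz_glue.

End Syz.
End Sheaves.

(* Main.v *)
(* A rank r subsheaf of the syzygy bundle has Pluecker coordinates which are
   forms of a common degree e, and its slope is - d - e / r.  Scaling the k-th
   coordinate by the k-th monomial turns the syzygy relation into "the sum of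
   the coordinates is 0".  Reading off the coefficient of the largest leading
   monomial M of the scaled Pluecker coordinates gives an r-dimensional subspace
   of K^n, still inside the hyperplane of sum 0, such that M is divisible by the
   product of the monomials of each basis of its matroid.  Contracting circuits
   C one after the other, and dropping in each of them the element which costs
   least, bounds deg M from below.  This gives Brenner's criterion: the bundle
   is stable as soon as (d - deg gcd(C)) (n - 1) > (#|C| - 1) d for each set C
   of monomials with 1 < #|C| < n.

   A family satisfying the criterion is found by induction on N and d, adding to
   a family in N variables the multiples by the remaining variable of a family of
   degree d - 1.  For N = 2 and n <= 2 d + 1 the induction does not
   apply, and the family is taken on two edges of the triangle of monomials,
   with at most one further monomial (and by hand for n = 3, for d = 3, n = 7
   and for d = 2, n = 5). *)

Require Import Defs.
From HB Require Import structures.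
From mathcomp Require Import all_boot all_order all_fingroup all_algebra.
From mathcomp Require Import mpoly.
From mathcomp Require Import zify ring.

(** * Balanced families of monomials *)

Definition mdvd (g m : seq nat) : bool := all2 leq g m.

(* Brenner's inequality, for the set of all members divisible by a monomial g;
   delta = 1 gives the strict inequality (stability) and delta = 0 the weak one
   (semistability).  A monomial is its list of exponents. *)
Definition balanced (delta M d : nat) (s : seq (seq nat)) : Prop :=
  [/\ uniq s,
      forall m, m \in s -> size m = M /\ sumn m = d,
      forall i, i < M -> exists2 m, m \in s & nth 0 m i = d
    & forall g, size g = M -> 0 < sumn g < d ->
        (count (mdvd g) s).-1 * d + delta <= (d - sumn g) * (size s).-1].

Lemma balancedW delta M d s : balanced delta M d s -> balanced 0 M d s.
Proof.
by case=> us hs ps bs; split=> // g hg hd; have := bs g hg hd; lia.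
Qed.

Lemma mdvd_eq g m : mdvd g m -> sumn g = sumn m -> g = m.
Proof.
rewrite /mdvd; elim: g m => [|x g IH] [|y m] //= /andP[xy gm] e.
have le : sumn g <= sumn m.
  elim: g m gm {IH e} => [|u g IH] [|v m] //= /andP[uv gm].
  by have := IH _ gm; lia.
have e1 : x = y by lia.
by subst y; rewrite (IH m) //; lia.
Qed.

Lemma count_mdvd_same_degree g s : uniq s ->
  (forall m, m \in s -> sumn m = sumn g) -> count (mdvd g) s <= 1.
Proof.
move=> us hs; have -> : count (mdvd g) s = count (fun m => mdvd g m && (g == m)) s.
  apply: eq_in_count => m /hs hm; apply/idP/andP => [h|[]//]; split=> //.
  by apply/eqP/mdvd_eq.
apply: leq_trans (_ : count (pred1 g) s <= 1); last by rewrite count_uniq_mem // leq_b1.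
by apply: sub_count => m /andP[_ /eqP ->] /=; rewrite eqxx.
Qed.

(** * Families on two edges of the triangle of monomials *)

Lemma count_span p u n : 0 < count p (iota u n) ->
  exists i j, [/\ p i, p j, u <= i <= j, j < u + n & count p (iota u n) <= (j - i).+1].
Proof.
elim: n u => [|n IH] u //=.
case pu: (p u) => /= h; last first.
  by have [i [j [pi pj uij jn c]]] := IH u.+1 h; exists i, j; split=> //; lia.
case c0: (count p (iota u.+1 n)) => [|c].
  by exists u, u; split=> //; lia.
have h' : 0 < count p (iota u.+1 n) by rewrite c0.
by have [i [j [pi pj uij jn cc]]] := IH u.+1 h'; exists u, j; split=> //; lia.
Qed.

(** The edges run from [X_0^d] towards [X_1^d] and [X_2^d]. The second index starts at 1 because the
    common corner is already the entry [i = 0] of the first edge. *)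
Definition two_edges (d q1 q3 : nat) (x z : nat -> nat) : seq (seq nat) :=
  [seq [:: d - x i; x i; 0] | i <- iota 0 q1.+1] ++
  [seq [:: d - z i; 0; z i] | i <- iota 1 q3].

Lemma size_two_edges d q1 q3 x z : size (two_edges d q1 q3 x z) = (q1 + q3).+1.
Proof. by rewrite size_cat !size_map !size_iota addSn. Qed.

Lemma count_two_edges d q1 q3 x z a b c :
  count (mdvd [:: a; b; c]) (two_edges d q1 q3 x z) =
  count (fun i => [&& a <= d - x i, b <= x i & c == 0]) (iota 0 q1.+1) +
  count (fun i => [&& a <= d - z i, b == 0 & c <= z i]) (iota 1 q3).
Proof.
rewrite count_cat !count_map; congr (_ + _); apply: eq_count => i /=.
  by rewrite andbT leqn0.
by rewrite andbT leqn0.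
Qed.

(** A monomial [g] involving both [X_1] and [X_2] divides no member. If it involves only one of
    them, its multiples lie on one edge, with exponents spread over at most [D = d - deg g], and the
    gap hypothesis for that edge applies. If it is a power of [X_0], its multiples are the members
    of both edges near the corner, and the last hypothesis applies. *)
Lemma balanced_two_edges d q1 q3 x z :
  0 < d -> 0 < q1 -> 0 < q3 -> x 0 = 0 -> x q1 = d -> z 0 = 0 -> z q3 = d ->
  (forall i, 0 < i <= q1 -> 0 < x i <= d) ->
  (forall i, 0 < i <= q3 -> 0 < z i <= d) ->
  (forall i j, 0 < i < j -> j <= q1 -> (j - i) * d < (x j - x i) * (q1 + q3)) ->
  (forall i j, 0 < i < j -> j <= q3 -> (j - i) * d < (z j - z i) * (q1 + q3)) ->
  (forall i j D, i <= q1 -> j <= q3 -> 0 < D < d -> x i <= D -> z j <= D ->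
     (i + j) * d < D * (q1 + q3)) ->
  balanced 1 3 d (two_edges d q1 q3 x z).
Proof.
move=> d0 q10 q30 x0 xq z0 zq hx hz gx gz hc.
have mx i j : i < j -> j <= q1 -> x i < x j.
  case: i => [|i] ij jq; first by rewrite x0; have := hx j; lia.
  have := gx i.+1 j; rewrite ij jq => /(_ isT isT); rewrite [x _ < _]ltnNge => h.
  apply/negP => le; have e : x j - x i.+1 = 0 by lia.
  by move: h; rewrite e mul0n.
have mz i j : i < j -> j <= q3 -> z i < z j.
  case: i => [|i] ij jq; first by rewrite z0; have := hz j; lia.
  have := gz i.+1 j; rewrite ij jq => /(_ isT isT); rewrite [z _ < _]ltnNge => h.
  apply/negP => le; have e : z j - z i.+1 = 0 by lia.
  by move: h; rewrite e mul0n.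
have bx i : i <= q1 -> x i <= d.
  by case: i => [|i] h; [rewrite x0|have := hx i.+1 h; lia].
have bz i : i <= q3 -> z i <= d.
  by case: i => [|i] h; [rewrite z0|have := hz i.+1 h; lia].
split.
- rewrite cat_uniq; apply/and3P; split.
  + rewrite map_inj_in_uniq ?iota_uniq // => i j; rewrite !mem_iota => hi hj [_ e].
    by case: (ltngtP i j) => // ij; [have := mx i j ij|have := mx j i ij]; lia.
  + apply/hasPn => m /mapP[i]; rewrite mem_iota => hi ->.
    by apply/negP => /mapP[j _ [_ _]]; have := hz i; lia.
  + rewrite map_inj_in_uniq ?iota_uniq // => i j; rewrite !mem_iota => hi hj [_ e].
    by case: (ltngtP i j) => // ij; [have := mz i j ij|have := mz j i ij]; lia.
- move=> m; rewrite mem_cat => /orP[] /mapP[i]; rewrite mem_iota => hi ->; split=> //=.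
    by have := bx i; lia.
  by have := bz i; lia.
- case=> [|[|[|//]]] _.
  + exists [:: d - x 0; x 0; 0]; last by rewrite /= x0 subn0.
    by rewrite mem_cat; apply/orP; left; apply/mapP; exists 0.
  + exists [:: d - x q1; x q1; 0]; last by rewrite /= xq.
    rewrite mem_cat; apply/orP; left; apply/mapP; exists q1 => //.
    by rewrite mem_iota; lia.
  + exists [:: d - z q3; 0; z q3]; last by rewrite /= zq.
    rewrite mem_cat; apply/orP; right; apply/mapP; exists q3 => //.
    by rewrite mem_iota; lia.
case=> [|a [|b [|c [|//]]]] // _.
rewrite (_ : sumn _ = a + (b + c)); last by rewrite /= addn0.
rewrite count_two_edges size_two_edges succnK.
set D := d - _ => ha.
have hD : 0 < D < d by rewrite /D; lia.
set A := count _ (iota 0 _); set B := count _ (iota 1 _).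
have hA : 0 < A -> exists i j, [/\ c = 0, a <= d - x j, b <= x i, i <= j <= q1 &
    A <= (j - i).+1 ].
  move=> /count_span[i [j [/and3P[_ bi /eqP c0] /and3P[aj _ _] ij jq le]]].
  by exists i, j; split=> //; lia.
have hB : 0 < B -> exists i j, [/\ b = 0, a <= d - z j, c <= z i, 0 < i <= j /\ j <= q3 &
    B <= (j - i).+1 ].
  move=> /count_span[i [j [/and3P[_ /eqP b0 ci] /and3P[aj _ _] ij jq le]]].
  by exists i, j; split=> //; lia.
rewrite addn1.
have [b0|b0] := posnP b; have [c0|c0] := posnP c.
(* Here [g] is a power of [X_0]. The first edge contributes at most [i + 1] members and the second
   at most [j], since it omits the corner; so the count minus one is at most [i + j]. *)
- have [i [iq xi Ai]] : exists i, [/\ i <= q1, x i <= D & A <= i.+1].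
    case: (posnP A) => [->|/hA[i [j [_ h1 _ h2 h3]]]]; first by exists 0; split=> //; lia.
    by exists j; split; rewrite ?/D; have := bx j; lia.
  have [j [jq zj Bj]] : exists j, [/\ j <= q3, z j <= D & B <= j].
    case: (posnP B) => [->|/hB[i' [j [_ h1 _ [h2 h3] h4]]]].
      by exists 0; split=> //; lia.
    by exists j; split; rewrite ?/D; have := bz j; lia.
  apply: leq_ltn_trans (hc i j D iq jq hD xi zj).
  by rewrite leq_mul2r; apply/orP; right; lia.
- have A0 : A = 0 by case: (posnP A) => // /hA[i [j []]]; lia.
  case: (posnP B) => [B0|/hB[i [j [_ h1 h2 [h3 h4] h5]]]].
    by rewrite A0 B0 mul0n; lia.
  rewrite A0 add0n; move: (h3) => /andP[i0]; rewrite leq_eqVlt => /orP[/eqP e|lij].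
    subst j; have -> : B.-1 = 0 by lia.
    by rewrite mul0n; lia.
  have := gz i j; rewrite i0 lij h4 => /(_ isT isT) H.
  apply: leq_ltn_trans (leq_trans H _); rewrite leq_mul2r; apply/orP; right; first by lia.
  by rewrite /D; have := bz j; have := mz i j; lia.
- have B0 : B = 0 by case: (posnP B) => // /hB[i [j []]]; lia.
  case: (posnP A) => [A0|/hA[i [j [_ h1 h2 h3 h5]]]].
    by rewrite A0 B0 mul0n; lia.
  rewrite B0 addn0; move: (h3) => /andP[]; rewrite leq_eqVlt => /orP[/eqP e|lij] h4.
    subst j; have -> : A.-1 = 0 by lia.
    by rewrite mul0n; lia.
  have i0 : 0 < i by case: (i) h2 => //; rewrite x0; lia.
  have := gx i j; rewrite i0 lij h4 => /(_ isT isT) H.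
  apply: leq_ltn_trans (leq_trans H _); rewrite leq_mul2r; apply/orP; right; first by lia.
  by rewrite /D; have := bx j; have := mx i j; lia.
have A0 : A = 0 by case: (posnP A) => // /hA[i [j []]]; lia.
have B0 : B = 0 by case: (posnP B) => // /hB[i [j []]]; lia.
by rewrite A0 B0 mul0n; lia.
Qed.

(** Enlarging the family only relaxes the inequality for a [g] that does not divide [T], so the
    divisors of [T] are all that remains to be checked. *)
Lemma balanced_cons delta M d s T : balanced delta M d s ->
  T \notin s -> size T = M -> sumn T = d -> delta <= 1 -> 0 < size s ->
  (forall g, size g = M -> 0 < sumn g < d -> mdvd g T ->
     count (mdvd g) s * d + delta <= (d - sumn g) * size s) ->
  balanced delta M d (T :: s).
Proof.
move=> [us hs ps bs] Ts sT dT d1 s0 hT; split.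
- by rewrite /= Ts.
- by move=> m; rewrite in_cons => /orP[/eqP->|/hs].
- by move=> i /ps[m ms e]; exists m => //; rewrite in_cons ms orbT.
move=> g hg gd; rewrite [size _]/= succnK.
rewrite [count _ _]/=; case gT: (mdvd g T); first by rewrite add1n succnK; apply: hT.
rewrite add0n; apply: leq_trans (bs g hg gd) _; rewrite leq_mul2l leq_pred.
exact: orbT.
Qed.

(* The shift by one along the first edge makes the inequality strict for the
   powers of the first variable. *)
Lemma balanced_edges_shifted d h : 2 <= h < d ->
  let q1 := h./2 in let q3 := uphalf h in
  balanced 1 3 d (two_edges d q1 q3
    (fun i => if i == 0 then 0 else minn d (i * d %/ q1).+1)
    (fun i => (i * d + q3.-1) %/ q3)).
Proof.
move=> hd q1 q3.
have eh : q1 + q3 = h by rewrite /q1 /q3 uphalf_half; have := odd_double_half h; lia.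
have h2 : q1 <= q3 <= q1.+1 by rewrite /q1 /q3 uphalf_half; case: (odd h); lia.
have q10 : 0 < q1 by lia.
have q30 : 0 < q3 by lia.
set x := fun i : nat => _; set z := fun i : nat => _.
(* Below [q1] the cap [minn d] is inactive, and [x i] is the least integer above [i * d / q1]; in
   contrast, [z i] is the ceiling of [i * d / q3]. *)
have xE i : 0 < i < q1 -> i * d < q1 * x i <= i * d + q1.
  move=> hi; rewrite /x; case: eqP => [|_]; first by lia.
  have h1 := divn_eq (i * d) q1; have := ltn_pmod (i * d) q10.
  have : (i * d %/ q1).+1 <= d by rewrite ltn_divLR //; nia.
  by move=> /minn_idPr ->; nia.
have xq : x q1 = d by rewrite /x gtn_eqF // mulKn // (minn_idPl _).
have zE i : i * d <= q3 * z i < i * d + q3.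
  rewrite /z; have h1 := divn_eq (i * d + q3.-1) q3.
  by have := ltn_pmod (i * d + q3.-1) q30; nia.
have zq : z q3 = d.
  by have := zE q3; nia.
apply: balanced_two_edges => //; rewrite ?eh.
- by lia.
- by rewrite /z mul0n add0n divn_small //; lia.
- move=> i hi; have [iq|iq] := leqP q1 i.
    by rewrite (_ : i = q1) ?xq; lia.
  by have := xE i; nia.
- by move=> i hi; have := zE i; nia.
- move=> i j ij jq.
  have xi := xE i; have {}xi : i * d < q1 * x i <= i * d + q1 by apply: xi; lia.
  have xj : j * d <= q1 * x j.
    move: jq; rewrite leq_eqVlt => /orP[/eqP->|jq]; first by rewrite xq.
    by have := xE j; lia.
  set e := x j - x i.
  have H : (j - i) * d <= q1 * e.+1.
    by rewrite /e mulnBl mulnS mulnBr; lia.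
  have ji : d <= (j - i) * d by rewrite -[X in X <= _]mul1n leq_mul2r; lia.
  (* Rounding loses at most one unit. Gaps 0 and 1 contradict [H] because [2 * q1 <= h < d]; from
     gap 2 on, the loss is absorbed. *)
  by case: e H => [|[|e]] H; nia.
- move=> i j ij jq; have zi := zE i; have zj := zE j.
  set e := z j - z i.
  have H : (j - i) * d < q3 * e.+1.
    by rewrite /e mulnBl mulnS mulnBr; lia.
  have ji : d <= (j - i) * d by rewrite -[X in X <= _]mul1n leq_mul2r; lia.
  by case: e H => [|[|e]] H; nia.
move=> i j D iq jq hD xi zj.
have H1 : i * d < q1 * D.
  case: (posnP i) => [->|i0]; first by nia.
  have iq' : i < q1 by rewrite ltn_neqAle iq andbT; apply/eqP => ei; move: xi; rewrite ei xq; lia.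
  by have := xE i; nia.
have H3 : j * d <= q3 * D by have := zE j; nia.
by rewrite -eh; nia.
Qed.

(** The first edge is filled completely and the second only at its far end, by the [j] monomials
    nearest to [X_2^d]. This covers [n] from [d + 2] to [2 d]. *)
Lemma balanced_edges_full d j : 0 < j < d ->
  balanced 1 3 d (two_edges d d j id (fun i => if i == 0 then 0 else d - j + i)).
Proof.
move=> jd; apply: balanced_two_edges; rewrite ?subnn //; try by lia.
- by case: eqP; lia.
- by move=> i hi; case: eqP; lia.
- by move=> i i' hi hi'; nia.
- by move=> i i' hi hi'; case: eqP; case: eqP; nia.
move=> i i' D hi hi' hD xi; case: eqP => [->|_] zi; first by nia.
have h1 : i + i' + d <= D + D + j by move: xi => /=; lia.
have h2 : (i + i' + d) * d <= (D + D + j) * d by rewrite leq_mul2r h1 orbT.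
(* This product is exactly [D * (d + j) - (2 * D + j - d) * d], the slack in the required inequality
   after [h2]. *)
have h3 : 0 < (d - D) * (d - j) by rewrite muln_gt0 !subn_gt0; lia.
have e1 : D * d = D * (j + (d - j)) by congr (_ * _); lia.
have e2 : j * d = j * (D + (d - D)) by congr (_ * _); lia.
have e3 : d * d = (D + (d - D)) * (j + (d - j)) by congr (_ * _); lia.
by move: h2 h3 e1 e2 e3; move: (d - D) (d - j) => u v; lia.
Qed.

Lemma count_iota_le (p : pred nat) u n l k :
  (forall i, p i -> u <= i < u + n -> l <= i < k) ->
  count p (iota u n) <= k - l.
Proof.
move=> h; case: (posnP (count p (iota u n))) => [->//|/count_span[i [j [hi hj ij jn c]]]].
by have := h i hi; have := h j hj; lia.
Qed.

Lemma mulnD_leq k d D e : k < D -> e <= d -> k * d + e <= D * d.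
Proof. by move=> kD ed; have := leq_mul kD (leqnn d); rewrite mulSn; lia. Qed.

(** The extra monomial is [X_0 X_1^q3 X_2^q1]. Its exponents are crossed on purpose: at most [q1]
    members on the first edge are multiples of [X_1^b] with [b > 0], and [b <= q3] leaves
    [d - b > q1]; likewise on the second edge. As [d] monomials lie on the edges, the inequality is
    that fewer than [d - deg g] of them are divisible by [g]. *)
Lemma balanced_edges_shifted_cons d : 3 <= d -> exists s,
  size s = d.+1 /\ balanced 1 3 d s.
Proof.
move=> d3; have hd : 2 <= d.-1 < d by lia.
have /= := balanced_edges_shifted d d.-1 hd.
set q1 := (d.-1)./2; set q3 := uphalf d.-1; set x := fun i : nat => _.
set z := fun i : nat => _ => bs.
have eh : q1 + q3 = d.-1 by rewrite /q1 /q3 uphalf_half; have := odd_double_half d.-1; lia.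
have h2 : q1 <= q3 <= q1.+1 by rewrite /q1 /q3 uphalf_half; case: (odd _); lia.
have q10 : 0 < q1 by lia.
have q30 : 0 < q3 by lia.
have x0 : x 0 = 0 by [].
have xq : x q1 = d by rewrite /x gtn_eqF // mulKn // (minn_idPl _).
have zq : z q3 = d.
  by rewrite /z mulnC divnMDl // divn_small ?addn0 //; lia.
exists ([:: 1; q3; q1] :: two_edges d q1 q3 x z); split.
  by have /= -> := size_two_edges d q1 q3 x z; lia.
apply: balanced_cons => //.
- by apply/negP; rewrite mem_cat => /orP[] /mapP[i _ [_]]; lia.
- by rewrite /=; lia.
rewrite size_two_edges eh prednK; last by lia.
case=> [|a [|b [|c [|//]]]] // _.
rewrite (_ : sumn _ = a + (b + c)); last by rewrite /= addn0.
rewrite count_two_edges /= => hd' /and3P[a1 b1 /andP[c1 _]].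
suff : count (fun i => [&& a <= d - x i, b <= x i & c == 0]) (iota 0 q1.+1) +
  count (fun i => [&& a <= d - z i, b == 0 & c <= z i]) (iota 1 q3) < d - (a + (b + c)).
  by move=> h; apply: mulnD_leq => //; lia.
have hA : count (fun i => [&& a <= d - x i, b <= x i & c == 0]) (iota 0 q1.+1)
    <= (if a == 0 then q1.+1 else q1) - (if b == 0 then 0 else 1).
  apply: count_iota_le => i /and3P[ai bi _] hi; apply/andP; split.
    by case: eqP => // b0; case: i bi {ai hi} => //; rewrite x0; lia.
  case: eqP => a0; first by lia.
  by case: (eqVneq i q1) ai => [->|]; rewrite ?xq; lia.
have hA' : 0 < c -> count (fun i => [&& a <= d - x i, b <= x i & c == 0]) (iota 0 q1.+1) <= 0 - 0.
  by move=> c0; apply: count_iota_le => i /and3P[_ _]; lia.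
have hB : count (fun i => [&& a <= d - z i, b == 0 & c <= z i]) (iota 1 q3)
    <= (if a == 0 then q3.+1 else q3) - 1.
  apply: count_iota_le => i /and3P[ai bi _] hi; apply/andP; split; first by lia.
  case: eqP => a0; first by lia.
  by case: (eqVneq i q3) ai => [->|]; rewrite ?zq; lia.
have hB' : 0 < b -> count (fun i => [&& a <= d - z i, b == 0 & c <= z i]) (iota 1 q3) <= 0 - 0.
  by move=> c0; apply: count_iota_le => i /and3P[_]; lia.
move: hA hA' hB hB'; move: (count _ (iota 0 _)) (count _ (iota 1 _)) => A B.
by case: (a =P 0); case: (b =P 0); lia.
Qed.

(** The two edges without [X_0^(d-1) X_2] have [2 d] members, and [X_1^2 X_2^(d-2)] is added. Only
    divisors [X_1^b] with [b <= 2] and [X_2^c] with [c <= d - 2] have multiples on the edges; they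
    need [b + 1 < d] and [c + 1 < d], whence [d >= 4]. *)
Lemma balanced_edges_full_cons d : 4 <= d -> exists s,
  size s = d.*2.+1 /\ balanced 1 3 d s.
Proof.
move=> d4; have hd : 0 < d.-1 < d by lia.
have := balanced_edges_full d d.-1 hd.
set z := fun i => if i == 0 then 0 else d - d.-1 + i => bs.
have zE i : 0 < i -> z i = i.+1 by move=> i0; rewrite /z gtn_eqF //; lia.
exists ([:: 0; 2; d - 2] :: two_edges d d d.-1 id z); split.
  by have /= -> := size_two_edges d d d.-1 id z; lia.
apply: balanced_cons => //.
- by apply/negP; rewrite mem_cat => /orP[] /mapP[i _ [_]]; lia.
- by rewrite /=; lia.
rewrite size_two_edges.
case=> [|a [|b [|c [|//]]]] // _.
rewrite (_ : sumn _ = a + (b + c)); last by rewrite /= addn0.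
rewrite count_two_edges [mdvd _ _]/= => hd' /and3P[a1 b1 /andP[c1 _]].
suff : count (fun i => [&& a <= d - i, b <= i & c == 0]) (iota 0 d.+1) +
  count (fun i => [&& a <= d - z i, b == 0 & c <= z i]) (iota 1 d.-1) < (d - (a + (b + c))).*2.
  move=> h; rewrite (_ : (d + d.-1).+1 = d.*2); last by lia.
  by rewrite -doubleMr doubleMl; apply: mulnD_leq => //; lia.
have hA : count (fun i => [&& a <= d - i, b <= i & c == 0]) (iota 0 d.+1) <= d.+1 - b.
  by apply: count_iota_le => i /and3P[ai bi _] hi; lia.
have hA' : 0 < c -> count (fun i => [&& a <= d - i, b <= i & c == 0]) (iota 0 d.+1) <= 0 - 0.
  by move=> c0; apply: count_iota_le => i /and3P[_ _]; lia.
have hB : count (fun i => [&& a <= d - z i, b == 0 & c <= z i]) (iota 1 d.-1) <= d - c.-1.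
  by apply: count_iota_le => i /and3P[ai bi ci] hi; move: ci; rewrite zE; lia.
have hB' : 0 < b -> count (fun i => [&& a <= d - z i, b == 0 & c <= z i]) (iota 1 d.-1) <= 0 - 0.
  by move=> c0; apply: count_iota_le => i /and3P[_]; lia.
by move: hA hA' hB hB'; lia.
Qed.

(** The case [n = 2 d + 1] for [d = 3], by a family invariant under cyclic permutation of the
    variables; the divisors are enumerated. *)
Lemma balanced_cubics :
  balanced 1 3 3 [:: [:: 3; 0; 0]; [:: 0; 3; 0]; [:: 0; 0; 3]; [:: 2; 1; 0];
                     [:: 0; 2; 1]; [:: 1; 0; 2]; [:: 1; 1; 1]].
Proof.
split=> //.
- by move=> m; rewrite !inE => /orP[/eqP->//|]; do ! [case/orP=> [/eqP->//|]]; move=> /eqP->.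
- case=> [|[|[|//]]] _; [exists [:: 3; 0; 0]|exists [:: 0; 3; 0]|exists [:: 0; 0; 3]];
    by rewrite ?inE ?eqxx ?orbT.
case=> [|a [|b [|c [|//]]]] // _.
by case: a => [|[|[|a]]]; case: b => [|[|[|b]]]; case: c => [|[|[|c]]] //=; lia.
Qed.

(** Only the weak inequality holds: [X_0] divides three of the five conics, which gives the equality
    [2 * 2 = 1 * 4]. *)
Lemma balanced_conics :
  balanced 0 3 2 [:: [:: 2; 0; 0]; [:: 0; 2; 0]; [:: 0; 0; 2]; [:: 1; 1; 0]; [:: 1; 0; 1]].
Proof.
split=> //.
- by move=> m; rewrite !inE => /orP[/eqP->//|]; do ! [case/orP=> [/eqP->//|]]; move=> /eqP->.
- case=> [|[|[|//]]] _; [exists [:: 2; 0; 0]|exists [:: 0; 2; 0]|exists [:: 0; 0; 2]];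
    by rewrite ?inE ?eqxx ?orbT.
case=> [|a [|b [|c [|//]]]] // _.
by case: a => [|[|a]]; case: b => [|[|b]]; case: c => [|[|c]] //=; lia.
Qed.

Lemma balanced_pure_powers d : 0 < d ->
  balanced 1 3 d [:: [:: d; 0; 0]; [:: 0; d; 0]; [:: 0; 0; d]].
Proof.
move=> d0; split.
- by rewrite /= !inE !eqseq_cons !andbT; lia.
- by move=> m; rewrite !inE => /orP[/eqP->|/orP[]/eqP->]; split; rewrite //=; lia.
- case=> [|[|[|//]]] _; [exists [:: d; 0; 0]|exists [:: 0; d; 0]|exists [:: 0; 0; d]];
    by rewrite ?inE ?eqxx ?orbT.
case=> [|a [|b [|c [|//]]]] // _ h.
suff : count (mdvd [:: a; b; c]) [:: [:: d; 0; 0]; [:: 0; d; 0]; [:: 0; 0; d]] <= 1.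
  by move: h; rewrite [size _]/=; case: (count _ _) => [|[|//]] /=; lia.
by move: h => /=; do ! case: leqP => ?; lia.
Qed.

(** All monomials in two variables: [g] divides [d - deg g + 1] of them, so equality holds for every
    [g]. *)
Lemma balanced_edge d : 0 < d -> balanced 0 2 d [seq [:: d - i; i] | i <- iota 0 d.+1].
Proof.
move=> d0; split.
- by rewrite map_inj_uniq ?iota_uniq // => i j [].
- by move=> m /mapP[i]; rewrite mem_iota => hi ->; split=> //=; lia.
- case=> [|[|//]] _; [exists [:: d; 0]|exists [:: 0; d]] => //.
    by apply/mapP; exists 0; rewrite ?subn0.
  by apply/mapP; exists d; rewrite ?subnn // mem_iota; lia.
case=> [|a [|b [|//]]] // _.
rewrite size_map size_iota succnK count_map (_ : sumn _ = a + b); last by rewrite /= addn0.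
move=> h; rewrite addn0 leq_mul2r; apply/orP; right.
suff : count (preim (fun i => [:: d - i; i]) (mdvd [:: a; b])) (iota 0 d.+1) <= (d - a).+1 - b.
  by lia.
by apply: count_iota_le => i /= /and3P[]; lia.
Qed.

(** * Induction on the number of variables and the degree *)

Definition mulhead (m : seq nat) : seq nat := if m is x :: t then x.+1 :: t else [::].

Lemma mdvd_sumn g m : mdvd g m -> sumn g <= sumn m.
Proof.
rewrite /mdvd; elim: g m => [|u g IH] [|v m] //= /andP[uv gm].
by have := IH _ gm; lia.
Qed.

(** A multiple of the new variable divides at most the added power. For the other [g] the count is
    unchanged while the right side grows by [d - deg g], which makes a weak inequality strict. *)
Lemma balanced_add_power M d s : 0 < d -> 0 < size s -> balanced 0 M d s ->
  balanced 1 M.+1 d ((d :: nseq M 0) :: map (cons 0) s).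
Proof.
move=> d0 s0 [us hs ps bs]; split.
- rewrite /= map_inj_uniq ?us ?andbT; last by move=> ? ? [].
  by apply/negP => /mapP[m _ []]; lia.
- move=> m; rewrite in_cons => /orP[/eqP->|/mapP[m' /hs[h1 h2] ->]] /=; last by rewrite h1.
  by rewrite size_nseq sumn_nseq mul0n addn0.
- case=> [|i] iM; first by exists (d :: nseq M 0); rewrite ?in_cons ?eqxx.
  have [m ms e] := ps i iM; exists (0 :: m) => //.
  by rewrite in_cons; apply/orP; right; apply/mapP; exists m.
case=> [//|a g] [hg] gd.
rewrite [size _]/= size_map succnK.
rewrite (_ : count _ _ = mdvd (a :: g) (d :: nseq M 0) +
  count (mdvd (a :: g)) (map (cons 0) s)) // count_map.
case: a gd => [|a] gd.
  rewrite [sumn _]/= add0n in gd *.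
  rewrite (_ : mdvd (0 :: g) _ = false) ?add0n; last first.
    by apply/negP => h; have := @mdvd_sumn g (nseq M 0) h; rewrite sumn_nseq; lia.
  rewrite (eq_count (a2 := mdvd g)) //.
  apply: leq_trans (_ : (d - sumn g) * (size s).-1 + (d - sumn g) <= _).
    by have := bs g hg gd; lia.
  by rewrite addnC -mulnS prednK.
rewrite (eq_count (a2 := pred0)) // count_pred0 addn0.
by case: (mdvd _ _); rewrite mul0n muln_gt0 subn_gt0; lia.
Qed.

(** The term in [A] is handled by its own bound. After multiplication by [d], the bound on [B * d]
    leaves a slack of exactly [E * (m1 - d)]. *)
Lemma balanced_cat_ineq A B m0 m1 d D E : d.+1 = D.+1 + E -> 0 < E ->
  A * d.+1 <= D.+1 * m0 -> B * d <= D * m1 -> d < m1 ->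
  (A + B).+1 * d.+1 < D.+1 * (m0 + m1).+1.
Proof.
move=> e E0 h0 h1 m1d.
have d0 : 0 < d by lia.
suff h : B.+1 * d.+1 < D.+1 * m1.+1.
  by rewrite -[(A + B).+1]addnS -[(m0 + m1).+1]addnS mulnDl mulnDr; lia.
rewrite -(ltn_pmul2r d0) mulnAC mulSn mulnDl.
have h2 := leq_mul h1 (leqnn d.+1).
have e1 : d = D + E by lia.
have h3 : E * d < E * m1 by rewrite ltn_mul2l E0.
apply: leq_ltn_trans (leq_add (leqnn _) h2) _.
by rewrite e in h2 *; rewrite e1 in h3 *; nia.
Qed.

(* For g without the first variable, k = k0 + k1 members are divisible by g.
   In degrees d and d + 1, the 1 in k - 1 = (k0 - 1) + (k1 - 1) + 1 is paid for
   by the difference (size s1 - 1) * (deg g) / (d (d + 1)) between the two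
   bounds for k1 - 1. *)
Lemma balanced_cat M d s0 s1 : 0 < d -> 0 < size s0 ->
  balanced 0 M d.+1 s0 -> balanced 0 M.+1 d s1 ->
  d.+1 < size s1 -> (size s1).-1 < d * size s0 ->
  balanced 1 M.+1 d.+1 (map (cons 0) s0 ++ map mulhead s1).
Proof.
move=> d0 n0 [u0 h0 p0 b0] [u1 h1 p1 b1] n1 n01.
have injm : {in s1 &, injective mulhead}.
  by move=> [|x m] [|y m'] /h1[e _] /h1[e' _] //= [-> ->].
split.
- rewrite cat_uniq map_inj_uniq ?u0 ?map_inj_in_uniq ?u1 ?andbT //; last by move=> ? ? [].
  apply/hasPn => m /mapP[[|x m'] /h1[e _] -> //]; apply/negP => /mapP[? _].
  by case.
- move=> m; rewrite mem_cat => /orP[] /mapP[m' hm ->].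
    by have [<- <-] := h0 _ hm.
  by have [] := h1 _ hm; case: m' {hm} => [|x m'] //= <- <-.
- case=> [|i] iM.
    have [m ms e] := p1 0 iM; exists (mulhead m).
      by rewrite mem_cat; apply/orP; right; apply/mapP; exists m.
    by have [] := h1 _ ms; case: (m) e => //= x t -> _ _.
  have [m ms e] := p0 i iM; exists (0 :: m) => //.
  by rewrite mem_cat; apply/orP; left; apply/mapP; exists m.
case=> [//|a g] [hg] gd.
rewrite size_cat !size_map count_cat !count_map.
case: a gd => [|a] gd.
  rewrite [sumn _]/= add0n in gd *.
  rewrite (eq_count (a2 := mdvd g)) //.
  rewrite (_ : count (preim _ _) s1 = count (mdvd (0 :: g)) s1); last first.
    by apply: eq_in_count => -[|x m] /h1[].
  have H0 := b0 g hg gd.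
  set k0 := count _ s0 in H0 *; set k1 := count _ s1.
  (* In degree [deg g = d] the family [s1] gives no inequality, but then [g] divides at most one
     member, namely itself. *)
  have H1 : k1.-1 * d <= (d - sumn g) * (size s1).-1.
    case: (ltngtP (sumn g) d) => gd'; last 1 first.
    - have : k1 <= 1 by apply: count_mdvd_same_degree => // m /h1[]; rewrite /=; lia.
      by case: (k1) => [|[|]]; rewrite // mul0n.
    - by have := b1 (0 :: g); rewrite /= add0n addn0 -/k1; apply; [rewrite hg|lia].
    - by lia.
  rewrite addn0 in H0.
  have e : d.+1 = (d.+1 - sumn g) + sumn g by lia.
  have [D e'] : exists D, d.+1 - sumn g = D.+1 by exists (d - sumn g); lia.
  rewrite (_ : d - sumn g = D) in H1; last by lia.
  rewrite e' in e H0 *; have S0 : 0 < sumn g by lia.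
  have m1 : d < (size s1).-1 by lia.
  have := balanced_cat_ineq _ _ _ _ _ _ _ e S0 H0 H1 m1.
  rewrite (_ : ((size s0).-1 + _).+1 = (size s0 + size s1).-1); last by lia.
  by apply: leq_trans; rewrite addn1 ltnS leq_mul2r; apply/orP; right; lia.
rewrite (eq_count (a2 := pred0)) // count_pred0 add0n.
rewrite (_ : count (preim _ _) s1 = count (mdvd (a :: g)) s1); last first.
  by apply: eq_in_count => -[|x m] /h1[].
have k1s : count (mdvd (a :: g)) s1 <= size s1 by apply: count_size.
move: b1 => /(_ (a :: g)); rewrite /= in gd *; rewrite hg => /(_ erefl) b1.
rewrite addSn subSS addn1.
rewrite (_ : (size s0 + size s1).-1 = size s0 + (size s1).-1); last by lia.
(* From here [g] is a multiple of the new variable, and its quotient by that variable is tested on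
   [s1]. A constant quotient divides all of [s1]. Both cases reduce to
   [(size s1).-1 < d * size s0]. *)
case: (posnP (a + sumn g)) => [->|S0].
  apply: leq_ltn_trans (_ : (size s1).-1 * d.+1 < _).
    by rewrite leq_mul2r; apply/orP; right; lia.
  by rewrite subn0 mulnDr mulnS [d * _.-1]mulnC; lia.
have {}b1 : (count (mdvd (a :: g)) s1).-1 * d <= (d - (a + sumn g)) * (size s1).-1.
  by have := b1; rewrite addn0; apply; lia.
have D0 : 0 < d - (a + sumn g) by lia.
rewrite -(ltn_pmul2r d0) mulnAC.
apply: leq_ltn_trans (leq_mul b1 (leqnn d.+1)) _.
rewrite -!mulnA ltn_pmul2l // mulnS mulnDl [_ * d]mulnC.
by lia.
Qed.

Lemma bin_ge m k : 0 < k < m -> m <= 'C(m, k).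
Proof.
elim: m k => [|m IH] [|k] //= km; rewrite binS.
case: (ltngtP k.+1 m) => km'; last 1 first.
- by rewrite -km' binn binSn; lia.
- have c0 : 0 < 'C(m, k) by rewrite bin_gt0; lia.
  by have := IH k.+1 km'; lia.
- by lia.
Qed.

Lemma bin_ge2 N d : 1 < N -> 1 < d -> (N.+1).*2 <= 'C(d + N, N).
Proof.
case: N => [|N] // N0 d1; rewrite addnS binS.
have h2 := bin_ge (d + N) N.+1; have h3 := bin_ge (d + N) N.
by lia.
Qed.

(** With [e] the degree, the cases are [n = 3], [n <= e], [n = e + 1], [n <= 2 e], [n = 2 e + 1],
    and beyond that [balanced_cat] applied to a full edge and a family of degree [e - 1]. *)
Lemma exists_balanced_plane d n : 0 < d -> 3 <= n <= 'C(d + 2, 2) ->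
  exists s, size s = n /\ balanced ((d, n) != (2, 5)) 3 d s.
Proof.
elim: d n => [//|d IH] n _ hn.
set b := (_ != _).
have b1 s : balanced 1 3 d.+1 s -> balanced b 3 d.+1 s.
  by case: b => //; apply: balancedW.
have [n3|n3] := leqP n 3.
  exists [:: [:: d.+1; 0; 0]; [:: 0; d.+1; 0]; [:: 0; 0; d.+1]]; split=> /=; first by lia.
  by apply/b1/balanced_pure_powers.
have d0 : 0 < d.
  by case: d hn {IH b b1} => // ; rewrite (_ : 'C(1 + 2, 2) = 3) //; lia.
have [nd|nd] := leqP n d.+1.
  have hd : 2 <= n.-1 < d.+1 by lia.
  eexists; split; last by apply/b1; apply: (balanced_edges_shifted d.+1 n.-1 hd).
  by rewrite size_two_edges; have := odd_double_half n.-1; rewrite uphalf_half; lia.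
have [nd'|nd'] := leqP n d.+2.
  have hd : 3 <= d.+1 by lia.
  have [s [hs bs]] := balanced_edges_shifted_cons _ hd.
  by exists s; split; [lia|apply/b1].
have [nd2|nd2] := leqP n (d.+1).*2.
  have hd : 0 < n - d.+2 < d.+1 by lia.
  eexists; split; last by apply/b1; apply: (balanced_edges_full d.+1 (n - d.+2) hd).
  by rewrite size_two_edges; lia.
have [nd3|nd3] := leqP n (d.+1).*2.+1.
  have {nd nd' nd2 nd3} en : n = (d.+1).*2.+1 by lia.
  case: d => [|[|[|d]]] in IH hn b b1 d0 en *; rewrite en //.
  - by exists [:: [:: 2; 0; 0]; [:: 0; 2; 0]; [:: 0; 0; 2]; [:: 1; 1; 0]; [:: 1; 0; 1]];
      split=> //; rewrite /b en; exact: balanced_conics.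
  - by eexists; split; last by apply/b1; exact: balanced_cubics.
  have [//|s [hs bs]] := balanced_edges_full_cons d.+4.
  by exists s; split; [|apply/b1].
have e2 : 'C(d.+1 + 2, 2) = 'C(d + 2, 2) + d.+2.
  by rewrite addSn binS bin1; lia.
have hn' : 3 <= n - d.+2 <= 'C(d + 2, 2) by lia.
have [s1 [hs1 bs1]] := IH _ d0 hn'.
eexists; split; last first.
  apply/b1/(balanced_cat _ _ _ _ d0 _ (balanced_edge d.+1 isT) (balancedW _ _ _ _ bs1)).
  - by rewrite size_map.
  - by rewrite hs1; lia.
  rewrite hs1 size_map size_iota.
  have := bin2 (d + 2); have := odd_double_half ((d + 2) * (d + 2).-1).
  have -> : (d + 2) * (d + 2).-1 = d * d.+1 + d.*2 + 2.
    by rewrite addn2 /= mulSnr mulSnr mulnSr; lia.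
  rewrite (mulnSr d d.+1) (mulnSr d d); lia.
by rewrite size_cat !size_map size_iota hs1; lia.
Qed.

(** If [n] exceeds the number of monomials without the new variable by at most one, adding its power
    to a smaller family suffices; otherwise [n] is split between monomials without the new variable
    and multiples of it. *)
Theorem exists_balanced N d n : 2 <= N -> 0 < d -> N < n <= 'C(d + N, N) ->
  exists s, size s = n /\ balanced ((N, d, n) != (2, 2, 5)) N.+1 d s.
Proof.
case: N => [|[|N]] // _; elim: N d n => [|N IHN] d n.
  by move=> d0 hn; exact: exists_balanced_plane.
elim: d n => [//|d IHd] n _ hn.
rewrite (_ : (_ != _) = true) //.
have Cd : d.+1 + N.+2 <= 'C(d.+1 + N.+2, N.+2) by apply: bin_ge; lia.
have [nC|nC] := leqP n 'C(d.+1 + N.+2, N.+2).+1.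
  have [||s [hs bs]] := IHN d.+1 n.-1; [by []|by lia|].
  eexists; split; last first.
    by apply: (balanced_add_power _ _ s _ _ (balancedW _ _ _ _ bs)); lia.
  by rewrite /= size_map; lia.
move: hn; rewrite addnS binS => hn.
set C := 'C(_, N.+2) in Cd nC hn; set C1 := 'C(_, N.+3) in hn.
have d0 : 0 < d.
  by case: (d) @C1 hn Cd nC => // C1; rewrite /C1 add1n binn; lia.
have C1m : C1 * N.+3 = C * d.+1.
  by rewrite /C1 mulnC mul_bin_left /C mulnC; congr (_ * _); lia.
have C1d : C1 <= C * d.
  rewrite -(@leq_pmul2r N.+3) // C1m -mulnA leq_mul2l; apply/orP; right.
  by rewrite mulnS; nia.
have C1g : d.+1 + N.+2 <= C1 by apply: bin_ge; lia.
have C2 : (N.+3).*2 <= C by apply: bin_ge2; lia.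
(* [maxn d.+2 N.+4] is the least admissible [n1]. The choice makes [n0] as large as possible, as
   favoured by [n1.-1 < d * n0]. *)
have [n0 [n1 [en hn0 hn1 h1 h2]]] : exists n0 n1, [/\ n = n0 + n1, N.+2 < n0 <= C,
    N.+3 < n1 <= C1, d.+1 < n1 & n1.-1 < d * n0].
  have [h|h] := leqP (C + maxn d.+2 N.+4) n.
    exists C, (n - C); split; rewrite // 1?mulnC; lia.
  exists (n - maxn d.+2 N.+4), (maxn d.+2 N.+4); split; try lia.
  case: (leqP d.+2 N.+4) => h'; last first.
    have h3 : N.+3 <= n - d.+2 by lia.
    by have := leq_mul (leqnn d) h3; nia.
  have h3 : N.+4 <= n - N.+4 by lia.
  by have := leq_mul d0 h3; nia.
have [s0 [hs0 bs0]] := IHN d.+1 n0 isT hn0.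
have hn1' : N.+3 < n1 <= 'C(d + N.+3, N.+3) by rewrite addnS -addSn.
have [s1 [hs1 bs1]] := IHd n1 d0 hn1'.
eexists; split; last first.
  apply: (balanced_cat _ _ s0 s1 d0 _ (balancedW _ _ _ _ bs0) (balancedW _ _ _ _ bs1)); lia.
by rewrite size_cat !size_map; lia.
Qed.

Set Implicit Arguments.
Unset Strict Implicit.
Unset Printing Implicit Defensive.
Import Order.TTheory GRing.Theory Num.Theory.
Local Open Scope ring_scope.

(** * Bases of a configuration of vectors with sum zero *)

Lemma big_disjoint_setU (T : finType) (A B : {set T}) (F : T -> nat) :
  [disjoint A & B] ->
  (\sum_(k in A :|: B) F k = \sum_(k in A) F k + \sum_(k in B) F k)%N.
Proof.
move=> dAB; rewrite (eq_bigl [predU A & B]) => [|k]; last by rewrite !inE.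
by rewrite bigU.
Qed.

(** One contraction step: [x] and [e] are the rank and the surplus degree of the circuit, [y] and
    [W] belong to what remains. The circuit brings its own [delta], enough for the single one
    required. *)
Lemma greedy_bases_ineq x y d h delta e S W :
  (x * d + delta <= e * h -> S = x * d + e ->
   y * d * h.+1 + (0 < y) * delta <= W * h ->
   (x + y) * d * h.+1 + (0 < x + y) * delta <= S * h + W * h)%N.
Proof.
move=> h1 -> h2; rewrite !mulnDl [(x * d * _)%N]mulnS.
have h3 : ((0 < x + y) * delta <= delta + (0 < y) * delta)%N.
  by case: (0 < x + y)%N; rewrite ?mul1n ?mul0n ?leq_addr.
by lia.
Qed.

Section Span.
Variables (K : fieldType) (n r : nat) (v : 'M[K]_(n, r)).

Definition row_span (A : {set 'I_n}) : 'M[K]_r := (\sum_(k in A) <<row k v>>)%MS.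

Lemma row_spanD1 k (A : {set 'I_n}) : k \in A ->
  (row_span A :=: row k v + row_span (A :\ k))%MS.
Proof.
move=> kA; rewrite /row_span (big_setD1 k kA) /=.
by apply/eqmxP/andP; split; apply/addsmxS; rewrite ?genmxE ?submx_refl.
Qed.

Lemma row_spanS (A B : {set 'I_n}) : A \subset B -> (row_span A <= row_span B)%MS.
Proof.
move=> /subsetP AB; apply/sumsmx_subP => k /AB kB.
by apply: (sumsmx_sup k).
Qed.

Lemma row_spanU (A B : {set 'I_n}) :
  (row_span (A :|: B) <= row_span A + row_span B)%MS.
Proof.
apply/sumsmx_subP => k; rewrite inE => /orP[] kA.
  by apply: submx_trans (addsmxSl _ _); apply: (sumsmx_sup k).
by apply: submx_trans (addsmxSr _ _); apply: (sumsmx_sup k).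
Qed.

Lemma rank_addsmx_row_span (U : 'M[K]_r) (A : {set 'I_n}) :
  (\rank (U + row_span A)%MS <= \rank U + #|A|)%N.
Proof.
have [m cA] := ubnP #|A|; elim: m A cA => // m IH A cA.
have [->|[k kA]] := set_0Vmem A.
  by rewrite cards0 addn0 /row_span big_set0 addsmx0.
have cAk := cardsD1 k A; rewrite kA add1n in cAk.
have le : (U + row_span A <= (U + row_span (A :\ k)) + row k v)%MS.
  rewrite -addsmxA addsmxS ?submx_refl //.
  by rewrite (row_spanD1 kA) addsmxC submx_refl.
apply: leq_trans (mxrankS le) _.
apply: leq_trans (mxrank_adds_leqif _ _).1 _.
apply: leq_trans (leq_add (IH _ _) (rank_leq_row _)) _; first by lia.
by rewrite cAk addn1 addnS.
Qed.

(** [C] is a circuit of the matroid of the rows in [A] contracted by [U]: an inclusion-minimal set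
    dependent modulo [U]. The sum relation makes [A] itself dependent. *)
Lemma minimal_dependent (U : 'M[K]_r) (A : {set 'I_n}) : A != set0 ->
  ((\sum_(k in A) row k v)%R <= U)%MS ->
  exists C : {set 'I_n}, [/\ C \subset A, C != set0,
    (\rank (U + row_span C)%MS).+1 = (\rank U + #|C|)%N
    & forall k, k \in C -> (U + row_span C <= U + row_span (C :\ k))%MS].
Proof.
move=> /set0Pn[k kA] sA.
pose P C := (\rank (U + row_span C)%MS < \rank U + #|C|)%N.
have PA : P A.
  have cAk := cardsD1 k A; rewrite kA add1n in cAk.
  rewrite /P cAk addnS ltnS; apply: leq_trans (rank_addsmx_row_span U (A :\ k)).
  apply: mxrankS; rewrite addsmx_sub addsmxSl (row_spanD1 kA) addsmx_sub addsmxSr andbT.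
  rewrite (big_setD1 k kA) /= in sA.
  rewrite -[X in (X <= _)%MS](addrK (\sum_(i in A :\ k) row i v)) addmx_sub //.
    exact: submx_trans sA (addsmxSl _ _).
  rewrite eqmx_opp; apply: submx_trans (addsmxSr _ _).
  by apply: summx_sub => i iA; apply: (sumsmx_sup i) => //; rewrite genmxE.
have [C /minsetP[PC minC] CA] := minset_exists PA.
have ge i : i \in C -> (\rank U + #|C| <= (\rank (U + row_span (C :\ i))%MS).+1)%N.
  move=> iC; have := cardsD1 i C; rewrite iC add1n => cC.
  rewrite cC addnS ltnS leqNgt; apply/negP => h.
  have := minC _ h (subD1set _ _) => /setP/(_ i).
  by rewrite !inE eqxx iC.
have sub i : (U + row_span (C :\ i) <= U + row_span C)%MS.
  by rewrite addsmxS ?submx_refl ?row_spanS ?subD1set.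
have C0 : C != set0.
  apply/eqP => e; move: PC; rewrite /P e cards0 addn0 ltnNge.
  by rewrite mxrankS ?addsmxSl.
exists C; split=> //.
  move/set0Pn: C0 => [i iC]; apply/eqP; rewrite eqn_leq; apply/andP; split; first exact: PC.
  by apply: leq_trans (ge i iC) _; rewrite ltnS mxrankS.
move=> i iC; rewrite -(mxrank_leqif_sup (sub i)).2 eqn_leq mxrankS //=.
by have := ge i iC; move: PC; rewrite /P; lia.
Qed.

(** Induction on [A]: a circuit [C] modulo [U] is added to [U], and the sum over the rest of [A]
    still lies in the new subspace. Any element of [C] may be dropped without changing the span, so
    the choice is made separately for each exponent [i]; this is why the basis [J] depends on
    [i]. *)
Lemma greedy_bases M d delta h (w : 'I_n -> 'I_M -> nat) :
  (forall k, \sum_i w k i = d)%N ->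
  (forall (C : {set 'I_n}) (g : 'I_M -> nat), (1 < #|C| <= r.+1)%N ->
     (forall k i, k \in C -> g i <= w k i)%N ->
     (#|C|.-1 * d + delta <= (d - \sum_i g i) * h)%N) ->
  forall (A : {set 'I_n}) (U : 'M[K]_r), ((\sum_(k in A) row k v)%R <= U)%MS ->
  exists W : 'I_M -> nat,
    (forall i, exists J : {set 'I_n},
       [/\ J \subset A, (U + row_span A <= U + row_span J)%MS,
           (#|J| + \rank U = \rank (U + row_span A)%MS)%N
         & (W i <= \sum_(k in J) w k i)%N]) /\
    let rho := (\rank (U + row_span A)%MS - \rank U)%N in
    (rho * d * h.+1 + (0 < rho) * delta <= (\sum_i W i) * h)%N.
Proof.
move=> wd hC A; have [m cA] := ubnP #|A|; elim: m A cA => // m IH A cA U sA.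
have [A0|A0] := eqVneq A set0.
  exists (fun=> 0%N); have e : \rank (U + row_span A)%MS = \rank U.
    by rewrite A0 /row_span big_set0 addsmx0.
  split=> [i|]; last by rewrite /= e subnn.
  exists set0; split; rewrite ?sub0set ?cards0 ?add0n //.
  by rewrite A0 submx_refl.
have [C [CA C0 rC hC']] := minimal_dependent A0 sA.
pose D := A :\: C.
pose U' := (U + row_span C)%MS.
have cAC : (#|D| < m)%N.
  have := cardsID C A; rewrite (setIidPr CA) -/D => e.
  by move: C0; rewrite -card_gt0; lia.
have sA' : ((\sum_(k in D) row k v)%R <= U')%MS.
  have e : \sum_(k in A) row k v = \sum_(k in C) row k v + \sum_(k in D) row k v.
    by rewrite (big_setID C) /= (setIidPr CA).
  rewrite -[X in (X <= _)%MS](addKr (\sum_(k in C) row k v)) -e addrC addmx_sub //.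
    exact: submx_trans sA (addsmxSl _ _).
  rewrite eqmx_opp; apply: submx_trans (addsmxSr _ _).
  by apply: summx_sub => j jC; apply: (sumsmx_sup j) => //; rewrite genmxE.
have [W' [hW' sW']] := IH _ cAC U' sA'.
have UA : (U + row_span A :=: U' + row_span (D))%MS.
  apply/eqmxP/andP; split.
    rewrite addsmx_sub /U' -addsmxA addsmxSl /=.
    apply: submx_trans (addsmxSr _ _); apply: submx_trans (row_spanU _ _).
    by rewrite row_spanS //; apply/subsetP => k kA; rewrite !inE kA andbT orbN.
  rewrite !addsmx_sub addsmxSl /=.
  by apply/andP; split; apply: submx_trans (addsmxSr _ _); rewrite row_spanS ?subsetDl.
have [c0 c0C] : exists c0, c0 \in C by apply/set0Pn.
(* The cheapest element for the exponent [i]. These minima are the exponents of the gcd of [C], so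
   the kept weights sum to [(#|C| - 1) d + (d - deg gcd(C))]. *)
pose c i := [arg min_(k < c0 in C) w k i].
have cP i : c i \in C /\ forall k, k \in C -> (w (c i) i <= w k i)%N.
  by rewrite /c; case: arg_minnP.
exists (fun i => (\sum_(k in C :\ c i) w k i + W' i)%N); split.
  move=> i; have [J' [JA sJ cJ WJ]] := hW' i; have [ciC _] := cP i.
  have dis : [disjoint C :\ c i & J'].
    apply/pred0P => k /=; apply/negP => /andP[/setD1P[_ kC] /(subsetP JA)].
    by rewrite inE kC.
  exists ((C :\ c i) :|: J'); split.
  - rewrite subUset (subset_trans (subD1set _ _) CA) /=.
    exact: subset_trans JA (subsetDl _ _).
  - rewrite UA; apply: submx_trans sJ _.
    rewrite addsmx_sub; apply/andP; split.
      apply: submx_trans (hC' _ ciC) _.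
      by rewrite addsmxS ?submx_refl // row_spanS // subsetUl.
    by apply: submx_trans (addsmxSr _ _); rewrite row_spanS // subsetUr.
  - rewrite cardsU disjoint_setI0 // cards0 subn0 UA -cJ.
    have := cardsD1 (c i) C; rewrite ciC add1n => e.
    move: rC; rewrite -/U' e addnS => -[->].
    by rewrite addnAC addnC (addnC _ (\rank U)).
  - by rewrite big_disjoint_setU // leq_add2l.
rewrite big_split /= mulnDl UA.
have le1 : (\rank U <= \rank U')%N by rewrite mxrankS ?addsmxSl.
have le2 : (\rank U' <= \rank (U' + row_span (D))%MS)%N by rewrite mxrankS ?addsmxSl.
rewrite /= in sW'; set R := \rank (U' + _)%MS in sW' le2 *.
have C1 : (0 < #|C|)%N by rewrite card_gt0.
rewrite -/U' in rC.
have -> : (R - \rank U = #|C|.-1 + (R - \rank U'))%N by lia.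
set rho := (R - \rank U')%N in sW' *.
have eS : (\sum_i \sum_(k in C :\ c i) w k i + \sum_i w (c i) i = #|C| * d)%N.
  rewrite -big_split /=.
  under eq_bigr do rewrite addnC -(big_setD1 (c _) (cP _).1) /=.
  rewrite exchange_big /=.
  by under eq_bigr do rewrite wd; rewrite sum_nat_const.
set S := (\sum_i \sum_(k in C :\ c i) w k i)%N in eS *.
have gd : (\sum_i w (c i) i <= d)%N.
  by rewrite -(wd c0); apply: leq_sum => i _; apply: (cP i).2.
(* A circuit with one element is a row already in [U]; it adds neither rank nor weight. *)
have [C2|C2] := leqP 2 #|C|; last first.
  rewrite (_ : #|C|.-1 = 0)%N ?add0n; last by lia.
  exact: leq_trans sW' (leq_addl _ _).
have := hC C (fun i => w (c i) i).
rewrite C2 /= => /(_ _ _) H.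
have {}H : (#|C|.-1 * d + delta <= (d - \sum_i w (c i) i) * h)%N.
  apply: H; last by move=> k i /(cP i).2.
  by rewrite -(leq_add2l (\rank U)) -rC addnS ltnS (leq_trans (rank_leq_row _)) ?leq_addl.
have eS' : (S = #|C|.-1 * d + (d - \sum_i w (c i) i))%N.
  by move: eS; rewrite -{1}(prednK C1) mulSn; lia.
exact: greedy_bases_ineq H eS' sW'.
Qed.

End Span.

Lemma greedy_minors (K : fieldType) n r (v : 'M[K]_(n, r)) M d delta h
    (w : 'I_n -> 'I_M -> nat) :
  (0 < r)%N -> row_full v -> \sum_k row k v = 0 ->
  (forall k, \sum_i w k i = d)%N ->
  (forall (C : {set 'I_n}) (g : 'I_M -> nat), (1 < #|C| <= r.+1)%N ->
     (forall k i, k \in C -> g i <= w k i)%N ->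
     (#|C|.-1 * d + delta <= (d - \sum_i g i) * h)%N) ->
  exists W : 'I_M -> nat,
    (forall i, exists g : 'I_r -> 'I_n,
       \det (rowsub g v) != 0 /\ (W i <= \sum_j w (g j) i)%N) /\
    (r * d * h.+1 + delta <= (\sum_i W i) * h)%N.
Proof.
move=> r0 fv sv wd hC.
have s0 : ((\sum_(k in [set: 'I_n]) row k v)%R <= (0 : 'M[K]_r))%MS.
  by rewrite (eq_bigl xpredT) ?sv ?sub0mx // => k; rewrite inE.
have [W [hW sW]] := greedy_bases wd hC s0.
have vT : (v <= row_span v [set: 'I_n])%MS.
  by apply/row_subP => k; apply: (sumsmx_sup k); rewrite ?inE ?genmxE.
have rT : \rank (row_span v [set: 'I_n]) = r.
  by apply/eqP; rewrite -[_ == r]/(row_full _) -sub1mx (submx_trans _ vT) ?sub1mx.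
have r0' : \rank ((0 : 'M[K]_r) + row_span v [set: 'I_n])%MS = r by rewrite adds0mx.
exists W; split; last first.
  by move: sW; rewrite /= r0' mxrank0 subn0 r0 mul1n.
move=> i; have [J [_ sJ cJ WJ]] := hW i.
rewrite r0' mxrank0 addn0 in cJ.
exists (fun j => enum_val (cast_ord (esym cJ) j)); split; last first.
  apply: leq_trans WJ _; rewrite big_enum_val /=.
  rewrite (reindex (cast_ord (esym cJ))) //=.
  by exists (cast_ord cJ) => j _; rewrite ?cast_ordK ?cast_ordKV.
rewrite -unitfE -unitmxE -row_full_unit.
rewrite -sub1mx (submx_trans (submx_full _ fv)) // (submx_trans vT) //.
have := sJ; rewrite !adds0mx => /submx_trans; apply.
apply/sumsmx_subP => k kJ; rewrite genmxE.
have -> : row k v = row (cast_ord cJ (enum_rank_in kJ k)) 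
    (rowsub (fun j => enum_val (cast_ord (esym cJ) j)) v).
  by apply/rowP => j; rewrite !mxE cast_ordK enum_rankK_in.
exact: row_sub.
Qed.

(** * Leading forms of Pluecker coordinates *)

Definition replace_at (T : Type) r (g : 'I_r -> T) (j : 'I_r) (k : T) (i : 'I_r) : T :=
  if i == j then k else g i.

(** Cramer's rule: expand along the replaced column, whose cofactors do not see the new entries. *)
Lemma det_replace_col (R : comNzRingType) r n (A : 'M[R]_(r, n)) (g : 'I_r -> 'I_n) j k :
  \det (colsub (replace_at g j k) A) = (\adj (colsub g A) *m A) j k.
Proof.
rewrite (expand_det_col _ j) mxE; apply: eq_bigr => i _.
rewrite !mxE /replace_at eqxx mulrC; congr (_ * _).
rewrite /cofactor; congr (_ * \det _); apply/matrixP => a b; rewrite !mxE.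
by rewrite eq_sym (negbTE (neq_lift _ _)).
Qed.

Lemma colsub_mulmx (R : comNzRingType) m r n p (A : 'M[R]_(m, r)) (B : 'M[R]_(r, n))
    (g : 'I_p -> 'I_n) : colsub g (A *m B) = A *m colsub g B.
Proof. by apply/matrixP => i j; rewrite !mxE; apply: eq_bigr => k _; rewrite !mxE. Qed.

Section LeadingForm.
Variables (K : fieldType) (n : nat).
Implicit Types p : {mpoly K[n]}.

Lemma mleadM_bound p q a b : (mlead p <= a)%O -> (mlead q <= b)%O ->
  (mlead (p * q) <= (a + b)%MM)%O.
Proof. by move=> pa qb; apply: le_trans (mleadM_le _ _) _; apply: lem_add. Qed.

Lemma mleadX_bound p M k : (mlead p <= M)%O ->
  (mlead (p ^+ k) <= (M *+ k)%MM)%O /\ (p ^+ k)@_(M *+ k) = p@_M ^+ k.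
Proof.
move=> pM; elim: k => [|k [IH1 IH2]].
  by rewrite !expr0 mulm0n mlead1 lexx mcoeff1 eqxx.
by rewrite !exprS mulmS mleadcMW // IH2 mleadM_bound.
Qed.

Lemma mlead_prod_bound r (p : 'I_r -> {mpoly K[n]}) M : (forall i, (mlead (p i) <= M)%O) ->
  (mlead (\prod_i p i) <= (M *+ r)%MM)%O /\ (\prod_i p i)@_(M *+ r) = \prod_i (p i)@_M.
Proof.
elim: r p => [|r IH] p pM.
  by rewrite !big_ord0 mulm0n mlead1 lexx mcoeff1 eqxx.
have [IH1 IH2] := IH _ (fun i => pM (lift ord0 i)).
by rewrite !big_ord_recl mulmS mleadcMW // IH2 mleadM_bound.
Qed.

(** [M] need not be the leading monomial of every entry. Under a common bound, taking the
    coefficient at the extreme monomial is multiplicative, with zero allowed, and so commutes with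
    the determinant. *)
Lemma mlead_det_bound r (A : 'M[{mpoly K[n]}]_r) M : (forall i j, (mlead (A i j) <= M)%O) ->
  (mlead (\det A) <= (M *+ r)%MM)%O /\ (\det A)@_(M *+ r) = \det (map_mx (mcoeff M) A).
Proof.
move=> AM; have sM (s : 'S_r) := mlead_prod_bound (fun i => AM i (s i)).
have sgE (s : 'S_r) p : (-1) ^+ s * p = (-1) ^+ s *: p.
  by case: (odd_perm s); rewrite ?expr1 ?expr0 ?mulN1r ?scaleN1r ?mul1r ?scale1r.
split.
  rewrite /determinant; elim/big_ind: _ => [|p q pM qM|s _].
  - by rewrite mlead0 le0m.
  - by apply: le_trans (mleadD_le _ _) _; rewrite leUx pM.
  - by rewrite sgE; apply: le_trans (mleadZ_le _ _) (sM s).1.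
rewrite /determinant raddf_sum /=; apply: eq_bigr => s _.
rewrite sgE mcoeffZ (sM s).2; congr (_ * _).
by apply: eq_bigr => i _; rewrite mxE.
Qed.

End LeadingForm.

Lemma row_free_minor (F : fieldType) r n (B : 'M[F]_(r, n)) : row_free B ->
  exists g : 'I_r -> 'I_n, \det (colsub g B) != 0.
Proof.
move=> fB; have fT : row_full B^T by rewrite /row_full mxrank_tr.
exists (fullrankfun fT); rewrite -det_tr.
have -> : (colsub (fullrankfun fT) B)^T = rowsub (fullrankfun fT) B^T.
  by apply/matrixP => i j; rewrite !mxE.
by rewrite -unitfE -unitmxE fullrowsub_unit.
Qed.

Section Bound.
Variables (K F : fieldType) (N : nat) (iota : {rmorphism {mpoly K[N]} -> F}).
Hypothesis iota_inj : injective iota.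
Local Notation S := {mpoly K[N]}.

(** The weights produced by [greedy_minors] for the coefficient matrix [v] are at most the exponents
    of the largest leading monomial [M], whose degree is [e + r * d]. *)
Lemma plucker_degree_bound r n d delta h e (m : 'I_n -> 'X_{1..N})
    (B : 'M[F]_(r, n)) (w : F) (P : {ffun 'I_r -> 'I_n} -> S) :
  (0 < r)%N -> w != 0 -> row_free B ->
  (forall i, \sum_k iota 'X_[m k] * B i k = 0) ->
  (forall k, mdeg (m k) = d) ->
  (forall g, iota (P g) = w * \det (colsub g B)) ->
  (forall g, P g \is e.-homog) ->
  (forall (C : {set 'I_n}) (g : 'I_N -> nat), (1 < #|C| <= r.+1)%N ->
     (forall k i, k \in C -> g i <= m k i)%N ->
     (#|C|.-1 * d + delta <= (d - \sum_i g i) * h)%N) ->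
  (r * d * h.+1 + delta <= (e + r * d) * h)%N.
Proof.
move=> r0 w0 fB kerB md PE Pe hC.
pose B' := \matrix_(i, k) (iota 'X_[m k] * B i k).
have detB' g : \det (colsub g B') = iota (\prod_j 'X_[m (g j)]) * \det (colsub g B).
  have -> : colsub g B' = colsub g B *m diag_mx (\row_j iota 'X_[m (g j)]).
    by apply/matrixP => i j; rewrite mul_mx_diag !mxE mulrC.
  rewrite det_mulmx det_diag mulrC; congr (_ * _).
  by rewrite rmorph_prod; apply: eq_bigr => j _; rewrite mxE.
pose T (g : {ffun 'I_r -> 'I_n}) := (\sum_j m (g j))%MM.
pose Q (g : {ffun 'I_r -> 'I_n}) : S := P g * 'X_[T g].
have QE g : iota (Q g) = w * \det (colsub g B').
  by rewrite detB' /Q /T -mprodXE rmorphM PE mulrAC -mulrA.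
have Qdef g : Q g = P g * 'X_[T g] by [].
clearbody Q.
have [g1 hg1] := row_free_minor fB.
have Q0 : Q (finfun g1) != 0.
  apply: contra_neq hg1 => Q0; have := QE (finfun g1); rewrite Q0 rmorph0 detB'.
  rewrite (_ : colsub (finfun g1) B = colsub g1 B); last first.
    by apply/matrixP => i j; rewrite !mxE ffunE.
  move=> /esym/eqP; rewrite !mulf_eq0 (negbTE w0) /= -(rmorph0 iota) (inj_eq iota_inj).
  have -> : (\prod_j 'X_[m (finfun g1 j)] == 0 :> S) = false; last by move=> /eqP.
  by apply/negbTE/prodf_neq0 => j _; rewrite -msize_poly_eq0 msizeX.
case: (@Order.TotalTheory.arg_maxP _ _ _ (finfun g1) (fun g => Q g != 0) (fun g => mlead (Q g)) Q0).
move=> g0 {}Q0 maxg0; set M := mlead (Q g0).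
have QM g : (mlead (Q g) <= M)%O.
  by have [->|/maxg0 //] := eqVneq (Q g) 0; rewrite mlead0 le0m.
pose A := colsub g0 B'.
pose q j k := Q (finfun (replace_at g0 j k)).
have qE j k : iota (q j k) = w * (\adj A *m B') j k.
  rewrite QE -det_replace_col; congr (_ * \det _).
  by apply/matrixP => a b; rewrite !mxE ffunE.
pose v : 'M[K]_(n, r) := \matrix_(k, j) (q j k)@_M.
(* The identity behind this is that the determinant of the coordinates with one index exchanged is
   [Q g0 ^ (r - 1) * Q g]; the extra factor [Q g0] avoids the exponent [r - 1]. *)
have detv (g : 'I_r -> 'I_n) : (Q g0)@_M * \det (rowsub g v) = (Q g0)@_M ^+ r * (Q (finfun g))@_M.
  have E : Q g0 * \det (\matrix_(j, i) q j (g i)) = Q g0 ^+ r * Q (finfun g).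
    apply: iota_inj; rewrite !rmorphM rmorphXn !QE -det_map_mx.
    have -> : map_mx iota (\matrix_(j, i) q j (g i)) = w *: (\adj A *m colsub g B').
      by apply/matrixP => j i; rewrite !mxE qE !mxE; congr (_ * _);
        apply: eq_bigr => a _; rewrite !mxE.
    rewrite detZ det_mulmx -/A.
    have dA : \det A * \det (\adj A) = \det A ^+ r.
      by rewrite -det_mulmx mul_mx_adj det_scalar.
    have -> : colsub (finfun g) B' = colsub g B'.
      by apply/matrixP => a b; rewrite !mxE ffunE.
    by rewrite exprMn -dA; ring.
  have qM j i : (mlead ((\matrix_(j, i) q j (g i)) j i) <= M)%O by rewrite mxE; apply: QM.
  have [l1 c1] := mlead_det_bound qM.
  have [l2 c2] := mleadX_bound r (QM g0).
  have := congr1 (mcoeff (M + M *+ r)) E; rewrite mleadcMW // c1.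
  rewrite [(M + M *+ r)%MM]addmC mleadcMW // c2 => <-; congr (_ * _).
  by rewrite -det_tr; congr (\det _); apply/matrixP => a b; rewrite !mxE.
have v0 : \sum_k row k v = 0.
  apply/rowP => j; rewrite summxE mxE.
  under eq_bigr do rewrite !mxE.
  rewrite -raddf_sum /= (_ : \sum_k q j k = 0) ?mcoeff0 //.
  apply: iota_inj; rewrite rmorph_sum rmorph0 /=.
  under eq_bigr do rewrite qE mxE mulr_sumr.
  rewrite exchange_big big1 //= => a _; rewrite -mulr_sumr -mulr_sumr.
  by under eq_bigr do rewrite mxE; rewrite kerB !mulr0.
(* Exchanging an index of [g0] for another one of [g0] gives [Q g0] or 0, so these rows of [v] form
   a nonzero scalar matrix. *)
have fv : row_full v.
  have qg0 i j : q j (g0 i) = Q g0 *+ (j == i).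
    apply: iota_inj; rewrite qE rmorphMn /= QE -/A -mulrnAr; congr (_ * _).
    have := congr1 (fun X : 'M_r => X j i) (mul_adj_mx A); rewrite !mxE => <-.
    by apply: eq_bigr => a _; rewrite !mxE.
  have vg0 : rowsub g0 v = ((Q g0)@_M)%:M.
    by apply/matrixP => i j; rewrite !mxE qg0 mcoeffMn eq_sym.
  rewrite -sub1mx; apply: submx_trans (rowsub_sub g0 v).
  by rewrite vg0 sub1mx row_full_unit unitmxE det_scalar unitfE expf_neq0 // mleadc_eq0.
have wd k : (\sum_i m k i)%N = d by rewrite -mdegE md.
have [W [hW sW]] := greedy_minors r0 fv v0 wd hC.
apply: leq_trans sW _; rewrite leq_mul2r; apply/orP; right.
have Mdeg : mdeg M = (e + r * d)%N.
  have : Q g0 \is (e + r * d).-homog.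
    rewrite Qdef; apply: dhomogM (Pe g0) _; rewrite dhomogX /T /= mdeg_sum.
    by rewrite (eq_bigr (fun=> d)) // sum_nat_const card_ord.
  by move=> /dhomogP; apply; apply: mlead_supp.
rewrite -Mdeg mdegE; apply: leq_sum => i _.
have [g [dg Wg]] := hW i; apply: leq_trans Wg _.
(* A nonzero minor of [v] puts [M] in the support of [Q g = P g * 'X_[T g]], so [M] is divisible by
   the monomial of [T g]. *)
have Qg : (Q (finfun g))@_M != 0.
  apply/eqP => e0; move: (detv g); rewrite e0 mulr0 => /eqP.
  by rewrite mulf_eq0 (negbTE dg) orbF mleadc_eq0 (negbTE Q0).
move: Qg; rewrite -mcoeff_msupp Qdef (perm_mem (msuppMX _ _)) => /mapP[m' _ ->].
rewrite mnmDE /T mnm_sumE; apply: leq_trans (leq_addr _ _).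
by apply: leq_sum => j _; rewrite ffunE.
Qed.
End Bound.

(** * Slopes of subsheaves of O(a)^n *)

Section Twist.
Variables (K : fieldType) (N : nat).
Local Notation S := {mpoly K[N.+1]}.
Local Notation Frac := {fraction {mpoly K[N.+1]}}.

Lemma varX_neq0 (i : 'I_N.+1) m : var K i ^+ m != 0.
Proof. exact: expf_neq0 (var_neq0 K i). Qed.

Lemma twist_tofrac l i (p : S) : p \is l.-homog -> twist l%:Z i (tofrac p).
Proof.
by move=> hp; exists 0%N, l, p; split; rewrite ?add0r // expr0 invr1 mulr1.
Qed.

Lemma twist1 i : twist 0 i (1 : Frac).
Proof. by rewrite -tofrac1; apply: twist_tofrac; apply: dhomog1. Qed.

Lemma twist_N a i (s : Frac) : twist a i s -> twist a i (- s).
Proof.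
move=> [m [l [p [hp hl ->]]]]; exists m, l, (- p); split => //.
  by rewrite dhomogN.
by rewrite tofracN mulNr.
Qed.

Lemma twist_sign b a i (s : Frac) : twist a i ((-1) ^+ b * s) <-> twist a i s.
Proof.
rewrite -signr_odd; case: (odd b); rewrite ?expr0 ?expr1 ?mul1r // mulN1r.
by split=> /twist_N //; rewrite opprK.
Qed.

Lemma twist_sum a i (I : Type) (r : seq I) (P : pred I) (s : I -> Frac) :
  (forall j, P j -> twist a i (s j)) -> twist a i (\sum_(j <- r | P j) s j).
Proof. by move=> h; elim/big_ind: _ => //; [exact: twist_0 | exact: twist_D]. Qed.

Lemma twist_prod a i r (s : 'I_r -> Frac) :
  (forall j, twist a i (s j)) -> twist (a * r%:Z) i (\prod_j s j).
Proof.
elim: r s => [|r IH] s h; first by rewrite big_ord0 mulr0; apply: twist1.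
rewrite big_ord_recl (_ : a * r.+1%:Z = a + a * r%:Z); last by rewrite intS mulrDr mulr1.
by apply: twist_M; [apply: h | apply: IH].
Qed.

Lemma twist_det a i r (A : 'M[Frac]_r) :
  (forall j k, twist a i (A j k)) -> twist (a * r%:Z) i (\det A).
Proof.
move=> h; apply: twist_sum => s _; apply/twist_sign.
exact: twist_prod.
Qed.

Lemma twist_varz (i : 'I_N.+1) (c : int) : twist c i (var K i ^ c).
Proof.
case: c => [k|k] /=.
  exists 0%N, k, ('X_i ^+ k); split; first last.
  - by rewrite tofracXn expr0 invr1 mulr1.
  - by rewrite add0r.
  by have := @dhomogMn _ _ mdeg 1 'X_i k; rewrite mul1n; apply; rewrite dhomogX /= mdeg1.
exists k.+1, 0%N, 1; split; [exact: dhomog1 | by rewrite NegzE subrr|].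
by rewrite tofrac1 mul1r.
Qed.

Lemma twist_shift a c (i : 'I_N.+1) (s : Frac) : twist (a + c) i (s * var K i ^ c) <-> twist a i s.
Proof.
split=> h; last by apply: twist_M => //; apply: twist_varz.
have := twist_M h (twist_varz i (- c)); rewrite addrK -mulrA -expfzDr ?var_neq0 //.
by rewrite subrr expr0z mulr1.
Qed.

(** The global sections of [O(a)] are forms of degree [a]. Two charts suffice: comparing
    denominators in [X_0] and in the last variable, distinct since [N > 0], shows that the numerator
    is divisible by the whole power of [X_0]. *)
Lemma twist_homog a (s : Frac) : (0 < N)%N -> (forall i, twist a i s) ->
  exists p : S, [/\ s = tofrac p, p \is (absz a).-homog & s != 0 -> 0 <= a].
Proof.
move=> N0 h; have [m [l [p [hp hl sE]]]] := h ord0.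
have [m' [l' [q [_ _ sE']]]] := h ord_max.
have [s0|s0] := eqVneq s 0; first by exists 0; split; rewrite ?tofrac0 ?dhomog0.
pose u := (U_(ord0 : 'I_N.+1) *+ m)%MM.
have E : p * 'X_[U_(ord_max) *+ m'] = q * 'X_[u].
  apply/eqP; rewrite -tofrac_eq !tofracM /u -!mpolyXn !tofracXn -/(var K _) -/(var K _).
  move: sE'; rewrite sE => /(congr1 (fun x => x * var K ord_max ^+ m' * var K ord0 ^+ m)).
  by rewrite (divfK (varX_neq0 _ _)) => <-; rewrite mulrAC (divfK (varX_neq0 _ _)).
have uk k : k \in msupp p -> (u <= k)%MM.
  move=> kp; have : (U_(ord_max) *+ m' + k)%MM \in msupp (q * 'X_[u]).
    by rewrite -E (perm_mem (msuppMX _ _)) map_f.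
  rewrite (perm_mem (msuppMX _ _)) => /mapP[k' _ /mnmP/(_ ord0)].
  rewrite !mnmDE !mulmnE !mnm1E eqxx mul1n.
  have -> : (ord_max == ord0 :> 'I_N.+1) = false by rewrite -val_eqE /= eqn0Ngt N0.
  rewrite mul0n add0n => e; apply/mnm_lepP => i; rewrite mulmnE mnm1E.
  by case: eqP => [<-|]; rewrite ?mul0n // mul1n e leq_addr.
pose p' := \sum_(k <- msupp p) p@_k *: 'X_[k - u] : S.
have pE : p = p' * 'X_[u].
  rewrite {1}[p]mpolyE mulr_suml !big_seq; apply: eq_bigr => k /uk ku.
  by rewrite -scalerAl -mpolyXD submK.
have sp : s = tofrac p'.
  by rewrite sE {1}pE tofracM /u -mpolyXn tofracXn -/(var K _) (mulfK (varX_neq0 _ _)).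
have udeg : mdeg u = m by rewrite mdegMn mdeg1 mul1n.
have [k kp] : exists k, k \in msupp p.
  have p0 : p != 0 by apply: contra_neq s0 => p0; rewrite sE p0 tofrac0 mul0r.
  by exists (mlead p); apply: mlead_supp.
have lm : (m <= l)%N.
  by have := dhomog_mf hp kp; rewrite /= -(submK (uk _ kp)) mdegD udeg => <-; rewrite leq_addl.
have aE : a = (l - m)%N%:Z.
  by rewrite -subzn // hl addrC addKr.
exists p'; split=> //; last by rewrite aE.
rewrite aE /= /p' big_seq; apply: rpred_sum => j /[dup] jp /uk uj.
apply: dhomogZ; rewrite dhomogX /=; apply/eqP.
have := dhomog_mf hp jp; rewrite /= -{1}(submK uj) mdegD udeg => <-.
by rewrite addnK.
Qed.

End Twist.

Section Subsheaf.
Variables (K : fieldType) (N n : nat) (a : int).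
Local Notation S := {mpoly K[N.+1]}.
Local Notation Frac := {fraction {mpoly K[N.+1]}}.

Lemma generic_basis_rank r r' (F : subsheaf K N a n) (B : 'M[Frac]_(r, n))
    (B' : 'M[Frac]_(r', n)) : generic_basis F B -> generic_basis F B' -> r = r'.
Proof.
move=> [fB hB sB] [fB' hB' sB'].
have e : \rank B = r by apply/eqP.
have e' : \rank B' = r' by apply/eqP.
have l : (\rank B <= \rank B')%N by apply/mxrankS/row_subP => k; apply: sB'.
have l' : (\rank B' <= \rank B)%N by apply/mxrankS/row_subP => k; apply: sB.
by rewrite e e' in l l'; apply/eqP; rewrite eqn_leq l.
Qed.

(* Multiplication by a maximal minor of B maps det F into the r-th exterior
   power O(a r) of the factors. *)
Lemma minor_twist r (F : subsheaf K N a n) (B : 'M[Frac]_(r, n)) (w : Frac) c :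
  w != 0 ->
  (forall i g, det_sheaf F B i g <-> twist c i (g / w)) ->
  forall (g : 'I_r -> 'I_n) i, twist (a * r%:Z - c) i (w * \det (colsub g B)).
Proof.
move=> w0 hw g i.
(* The product with [\det X] is a minor of [X *m B], whose entries are sections of [O(a)]; the power
   of the variable brings it back to degree 0. *)
have dual : ext_dual F B i (\det (colsub g B) * var K i ^ (- (a * r%:Z))).
  move=> X hX; rewrite mulrAC [\det _ * _]mulrC -det_mulmx -colsub_mulmx.
  rewrite -(subrr (a * r%:Z)); apply/twist_shift/twist_det => j k.
  by have := sections_twist (hX j) (g k); rewrite !mxE.
have det_w : det_sheaf F B i (w * var K i ^ c).
  by apply/hw; rewrite [w * _]mulrC mulfK //; apply: twist_varz.
have := det_w _ dual; rewrite mulrACA => h.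
apply/(twist_shift _ (c + - (a * r%:Z))).
rewrite (_ : a * r%:Z - c + _ = 0); last by ring.
by rewrite expfzDr ?var_neq0.
Qed.

Lemma minors_homog r (F : subsheaf K N a n) (B : 'M[Frac]_(r, n)) (w : Frac) c :
  (0 < N)%N -> generic_basis F B -> w != 0 ->
  (forall i g, det_sheaf F B i g <-> twist c i (g / w)) ->
  exists e : nat, exists P : {ffun 'I_r -> 'I_n} -> S,
    [/\ e%:Z = a * r%:Z - c, forall g, P g \is e.-homog
       & forall g, tofrac (P g) = w * \det (colsub g B)].
Proof.
move=> N0 [fB _ _] w0 hw; have tw := minor_twist w0 hw.
have [g1 hg1] := row_free_minor fB.
have [_ [_ _ e0]] := twist_homog N0 (tw g1).
have {}e0 := e0 (mulf_neq0 w0 hg1).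
have ex (g : {ffun 'I_r -> 'I_n}) : exists p : S,
    p \is (absz (a * r%:Z - c)%R).-homog /\ tofrac p = w * \det (colsub g B).
  by have [p [e hp _]] := twist_homog N0 (tw g); exists p.
have [P hP] := fin_all_exists ex.
exists (absz (a * r%:Z - c)%R), P; split; first by rewrite gez0_abs.
  by move=> g; have [] := hP g.
by move=> g; have [] := hP g.
Qed.

End Subsheaf.

Section SyzBound.
Variables (K : fieldType) (N n d : nat) (m : 'I_n -> 'X_{1..N.+1}).
Local Notation S := {mpoly K[N.+1]}.
Local Notation Frac := {fraction {mpoly K[N.+1]}}.

(** With twist [- d] the Pluecker coordinates have degree [e = - r d - c], so [c = - (e + r d)], and
    the degree bound is used with [h = n - 1]. *)
Lemma c1_subsheaf_Syz delta (F : subsheaf K N (- d%:Z) n) r c :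
  (0 < N)%N -> (0 < r)%N -> (r.+1 < n)%N -> (forall k, mdeg (m k) = d) ->
  (forall (C : {set 'I_n}) (g : 'I_N.+1 -> nat), (1 < #|C| < n)%N ->
     (forall k i, k \in C -> g i <= m k i)%N ->
     (#|C|.-1 * d + delta <= (d - \sum_i g i) * n.-1)%N) ->
  subsheaf_of F (Syz d (fun j => 'X_[m j])) -> has_rank F r -> has_c1 F c ->
  c * n.-1%:Z + (r * d * n + delta)%N%:Z <= 0.
Proof.
move=> N0 r0 rn md hC FE [B0 hB0] [r' [B [w [hB w0 hw]]]].
have er := generic_basis_rank hB0 hB; subst r'.
have [e [P [eE Pe PE]]] := minors_homog N0 hB w0 hw.
have [fB rowB _] := hB.
pose iota : {rmorphism S -> Frac} := @tofrac S.
have iota_inj : injective iota.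
  by move=> p q /eqP; rewrite tofrac_eq => /eqP.
have kerB i : \sum_k iota 'X_[m k] * B i k = 0.
  have [_ h] := FE _ _ (rowB i); rewrite -[RHS]h.
  by apply: eq_bigr => k _; rewrite mxE.
have hC' (C : {set 'I_n}) (g : 'I_N.+1 -> nat) : (1 < #|C| <= r.+1)%N ->
     (forall k i, k \in C -> g i <= m k i)%N ->
     (#|C|.-1 * d + delta <= (d - \sum_i g i) * n.-1)%N.
  by move=> hCr; apply: hC; lia.
have := plucker_degree_bound iota_inj r0 w0 fB kerB md PE Pe hC'.
rewrite prednK; last by lia.
move: (r * d * n)%N => x h.
have {eE} -> : c = - (e + r * d)%N%:Z by rewrite PoszD eE PoszM; ring.
rewrite mulNr -PoszM addrC subr_le0 lez_nat.
exact: h.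
Qed.

End SyzBound.

(** * Rank and first Chern class of the syzygy bundle *)

Lemma kernel_minors (R : comNzRingType) n (B : 'M[R]_(n, n.+1)) (f : 'I_n.+1 -> R)
    (k l : 'I_n.+1) :
  (forall j, \sum_i f i * B j i = 0) ->
  f l * ((-1) ^+ k * \det (col' k B)) = (-1) ^+ l * \det (col' l B) * f k.
Proof.
move=> kerB.
(* The [l]-th unit row is placed above [B]. Then [M] sends the column [f] to [f l] times the first
   unit column, and applying the adjugate compares [\det M * f k] with a cofactor. *)
pose M : 'M[R]_n.+1 :=
  \matrix_(i, j) if unlift ord0 i is Some i' then B i' j else (j == l)%:R.
have cofM j : cofactor M ord0 j = (-1) ^+ j * \det (col' j B).
  rewrite /cofactor add0n; congr (_ * \det _).
  by apply/matrixP => a b; rewrite !mxE liftK.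
have detM : \det M = (-1) ^+ l * \det (col' l B).
  rewrite (expand_det_row _ ord0) (bigD1 l) //= big1 => [|j jl].
    by rewrite addr0 mxE unlift_none eqxx mul1r cofM.
  by rewrite mxE unlift_none (negbTE jl) mul0r.
have := congr1 (fun X : 'M_n.+1 => (X *m \col_i f i) k 0) (mul_adj_mx M).
rewrite mul_scalar_mx -mulmxA mxE [X in _ = X]mxE mxE detM => <-.
rewrite (bigD1 ord0) //= big1 => [|i i0]; last first.
  case: (unliftP ord0 i) i0 => [j ->|-> //] _.
  have -> : (M *m \col_i f i) (lift ord0 j) 0 = 0; last by rewrite mulr0.
  rewrite mxE -[RHS](kerB j); apply: eq_bigr => a _.
  by rewrite !mxE liftK mulrC.
rewrite addr0 !mxE cofM mulrC; congr (_ * _).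
rewrite (bigD1 l) //= big1 => [|j jl]; first by rewrite !mxE unlift_none eqxx mul1r addr0.
by rewrite !mxE unlift_none (negbTE jl) mul0r.
Qed.

Lemma signed_solve (F : fieldType) (b : nat) (x y z t : F) :
  x != 0 -> x * ((-1) ^+ b * y) = z * t -> y = (-1) ^+ b * (z / x * t).
Proof.
move=> x0 e; rewrite mulrAC -e [x * _]mulrC mulfK //.
by rewrite mulrA -expr2 sqrr_sign mul1r.
Qed.

Section SyzInvariants.
Variables (K : fieldType) (N d n : nat).
Local Notation S := {mpoly K[N.+1]}.
Local Notation Frac := {fraction {mpoly K[N.+1]}}.
Variables (f : 'I_n.+1 -> S) (kk : 'I_N.+1 -> 'I_n.+1).
Hypothesis f_homog : forall k, f k \is d.-homog.
Hypothesis f_kk : forall i, f (kk i) = 'X_i ^+ d.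

Local Notation x i := (var K i).

Let Syzf := Syz d f.

(** On [U_i] the generator [f (kk i) = 'X_i ^+ d] is invertible, so the syzygies are free on the
    vectors [X_i^(-d) e_k - f_k X_i^(-2d) e_(kk i)] for [k != kk i]. *)
Definition chart_basis (i : 'I_N.+1) : 'M[Frac]_(n, n.+1) :=
  \matrix_(j, k) if k == kk i then - (tofrac (f (lift (kk i) j)) * x i ^ (- (d + d)%N%:Z))
                 else (lift (kk i) j == k)%:R * x i ^ (- d%:Z).

Lemma tofrac_kk i : tofrac (f (kk i)) = x i ^ d%:Z.
Proof. by rewrite f_kk tofracXn. Qed.

Lemma chart_basis_col' i : col' (kk i) (chart_basis i) = (x i ^ (- d%:Z))%:M.
Proof.
apply/matrixP => j k; rewrite !mxE eq_sym (negbTE (neq_lift _ _)).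
by rewrite (inj_eq lift_inj); case: (j == k); rewrite ?mul1r ?mul0r.
Qed.

Lemma chart_basis_ker i j : \sum_k tofrac (f k) * chart_basis i j k = 0.
Proof.
rewrite (bigD1 (kk i)) //= (bigD1 (lift (kk i) j)) ?[_ == kk i]eq_sym ?neq_lift //=.
rewrite big1 => [|k /andP[/negbTE k1 /negbTE k2]]; last first.
  by rewrite mxE k1 eq_sym k2 mul0r mulr0.
rewrite addr0 !mxE !eqxx [_ == kk i]eq_sym (negbTE (neq_lift _ _)) tofrac_kk.
rewrite mulrN mulrCA -expfzDr ?var_neq0 // mul1r PoszD opprD addrA subrr add0r.
by rewrite addNr.
Qed.

Lemma chart_basis_sections i j : Syzf i (row j (chart_basis i)).
Proof.
split=> [k|]; last first.
  by under eq_bigr do rewrite mxE; apply: chart_basis_ker.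
rewrite !mxE; case: eqP => _.
  apply: twist_N; rewrite (_ : - d%:Z = d%:Z + - (d + d)%N%:Z); last by rewrite PoszD; ring.
  by apply: twist_M; [apply/twist_tofrac/f_homog | apply: twist_varz].
case: (_ == k); first by rewrite mul1r; apply: twist_varz.
by rewrite mul0r; apply: twist_0.
Qed.

Lemma chart_basisP i (v : 'rV[Frac]_n.+1) : \sum_k tofrac (f k) * v 0 k = 0 ->
  v = (x i ^ d%:Z *: col' (kk i) v) *m chart_basis i.
Proof.
move=> hv; pose u := (x i ^ d%:Z *: col' (kk i) v) *m chart_basis i.
have xx : x i ^ d%:Z * x i ^ (- d%:Z) = 1.
  by rewrite -expfzDr ?var_neq0 // subrr expr0z.
have uv k : k != kk i -> u 0 k = v 0 k.
  case: (unliftP (kk i) k) => [j ->|-> /eqP //] _.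
  have -> : u 0 (lift (kk i) j) = (col' (kk i) u) 0 j by rewrite !mxE.
  have -> : col' (kk i) u = (x i ^ d%:Z *: col' (kk i) v) *m col' (kk i) (chart_basis i).
    by apply/rowP => b; rewrite !mxE; apply: eq_bigr => a _; rewrite !mxE.
  by rewrite chart_basis_col' mul_mx_scalar !mxE mulrA [_ * x i ^ _]mulrC xx mul1r.
have hu : \sum_k tofrac (f k) * u 0 k = 0.
  under eq_bigr do rewrite mxE mulr_sumr.
  rewrite exchange_big big1 //= => j _.
  under eq_bigr do rewrite mulrCA.
  by rewrite -mulr_sumr chart_basis_ker mulr0.
apply/rowP => k; have [->|/uv->//] := eqVneq k (kk i).
have x0 : tofrac (f (kk i)) != 0 by rewrite tofrac_kk expfz_neq0 // var_neq0.
apply: (mulfI x0); move: (etrans hu (esym hv)); rewrite (bigD1 (kk i)) //= [RHS](bigD1 (kk i)) //=.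
rewrite (eq_bigr (fun k => tofrac (f k) * v 0 k)); last by move=> j /uv ->.
by move=> h; apply: esym; apply: addIr h.
Qed.

Let B := chart_basis ord0.

Lemma generic_basis_Syz : generic_basis Syzf B.
Proof.
split.
- have : \rank (col' (kk ord0) B) = n.
    rewrite chart_basis_col' mxrank_unit // unitmxE det_scalar unitfE expf_neq0 //.
    by rewrite expfz_neq0 // var_neq0.
  move=> rk; rewrite /row_free eqn_leq rank_leq_row -{1}rk -mxrank_tr -[X in (_ <= X)%N]mxrank_tr.
  have -> : (col' (kk ord0) B)^T = rowsub (lift (kk ord0)) B^T.
    by apply/matrixP => a b; rewrite !mxE.
  exact/mxrankS/rowsub_sub.
- by move=> k; apply: chart_basis_sections.
by move=> v [_ hv]; rewrite (chart_basisP ord0 hv); apply: submxMl.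
Qed.

Let T i : 'M[Frac]_n := x i ^ d%:Z *: col' (kk i) B.

Lemma chart_change i : B = T i *m chart_basis i.
Proof.
apply/row_matrixP => j; rewrite row_mul.
rewrite (_ : row j (T i) = x i ^ d%:Z *: col' (kk i) (row j B)); last first.
  by apply/rowP => k; rewrite !mxE.
apply: chart_basisP; under eq_bigr do rewrite mxE.
exact: chart_basis_ker.
Qed.

(** [T i] expresses [B] in the local basis of [U_i]. Forwards, [\det (T i)] is itself in the dual;
    backwards, the dual is tested on [invmx (T i)], which turns [B] into the local basis. *)
Lemma det_sheaf_Syz i g : \det (T i) != 0 -> det_sheaf Syzf B i g <-> twist 0 i (g * \det (T i)).
Proof.
move=> t0; split.
  move=> hg; apply: hg => C hC; rewrite mulrC -det_mulmx -[0](mul0r n%:Z).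
  apply: twist_det => j k; rewrite (_ : _ *m _ = x i ^ d%:Z *: col' (kk i) (C *m B)).
    rewrite mxE mulrC -(addNr d%:Z); apply/twist_shift.
    by have := sections_twist (hC j) (lift (kk i) k); rewrite !mxE.
  rewrite /T -scalemxAr; congr (_ *: _).
  by apply/matrixP => a b; rewrite !mxE; apply: eq_bigr => c _; rewrite !mxE.
move=> hg h hh.
have := hh (invmx (T i)); rewrite det_inv => /(_ _) h1.
have h2 : twist 0 i (h / \det (T i)).
  apply: h1 => k; rewrite {1}(chart_change i) mulKmx; first exact: chart_basis_sections.
  by rewrite unitmxE unitfE.
have := twist_M hg h2; rewrite addr0 mulrACA.
by rewrite [\det _ * _]mulrV ?unitfE // mulr1.
Qed.

Lemma has_c1_Syz : has_c1 Syzf (- (n.+1 * d)%N%:Z).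
Proof.
(* By [kernel_minors] the ratio of signed minor to generator is the same for every column. Hence
   [\det (T i)] is, up to sign, [lam] times a power of [X_i]: [n * d] comes from rescaling and [d]
   from the generator. *)
pose lam := (-1) ^+ (kk ord0) * \det (col' (kk ord0) B) / tofrac (f (kk ord0)).
have x0 i : tofrac (f (kk i)) != 0 by rewrite tofrac_kk expfz_neq0 // var_neq0.
have dB i : \det (T i) = (-1) ^+ (kk i) * (lam * x i ^ (n.+1 * d)%N%:Z).
  have h := kernel_minors (kk i) (kk ord0) (chart_basis_ker ord0).
  have e : \det (col' (kk i) B) = (-1) ^+ (kk i) * (lam * tofrac (f (kk i))).
    exact: signed_solve (x0 ord0) h.
  rewrite /T detZ e tofrac_kk mulrCA; congr (_ * _); rewrite mulrCA; congr (_ * _).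
  by rewrite mulSn PoszD addrC expfzDr ?var_neq0 // mulnC PoszM -exprz_exp exprnP.
have T1 : \det (T ord0) = 1.
  rewrite /T chart_basis_col' -mul_scalar_mx -scalar_mxM -expfzDr ?var_neq0 //.
  by rewrite subrr expr0z det1.
have lam0 : lam != 0.
  apply/eqP => l0; have /esym/eqP := dB ord0.
  by rewrite T1 l0 mul0r mulr0 eq_sym oner_eq0.
have t0 i : \det (T i) != 0.
  rewrite dB; apply: mulf_neq0; first by rewrite signr_eq0.
  exact: mulf_neq0 lam0 (expfz_neq0 _ (var_neq0 K i)).
exists n, B, lam^-1; split; [exact: generic_basis_Syz | by rewrite invr_neq0|].
move=> i g; rewrite invrK; apply: (iff_trans (det_sheaf_Syz g (t0 i))).
rewrite dB mulrCA; apply: (iff_trans (twist_sign _ _ _ _)).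
by rewrite mulrA -(addNr (n.+1 * d)%N%:Z); apply: twist_shift.
Qed.

Lemma has_slope_Syz : (0 < n)%N -> has_slope Syzf ((- (n.+1 * d)%N%:Z)%:~R / n%:R).
Proof.
move=> n0; exists n, (- (n.+1 * d)%N%:Z); split=> //.
  by exists B; exact: generic_basis_Syz.
exact: has_c1_Syz.
Qed.

End SyzInvariants.

(** * Monomial families *)

Section Primary.
Variables (K : fieldType) (N n : nat).
Local Notation S := {mpoly K[N.+1]}.
Implicit Types (f : 'I_n -> S) (p q : S).

Lemma ideal_gen0 f : ideal_gen f 0.
Proof. by exists (fun=> 0); rewrite big1 // => j _; rewrite mulr0. Qed.

Lemma ideal_genD f p q : ideal_gen f p -> ideal_gen f q -> ideal_gen f (p + q).
Proof.
move=> [g ->] [h ->]; exists (fun j => g j + h j).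
by rewrite -big_split; apply: eq_bigr => j _; rewrite mulrDr.
Qed.

Lemma ideal_genM f p q : ideal_gen f p -> ideal_gen f (p * q).
Proof.
move=> [g ->]; exists (fun j => g j * q).
by rewrite mulr_suml; apply: eq_bigr => j _; rewrite mulrA.
Qed.

Lemma ideal_gen_sum f (I : Type) (r : seq I) (P : pred I) (F : I -> S) :
  (forall i, P i -> ideal_gen f (F i)) -> ideal_gen f (\sum_(i <- r | P i) F i).
Proof. by move=> h; elim/big_ind: _ => //; [exact: ideal_gen0 | exact: ideal_genD]. Qed.

Lemma ideal_gen_mem f j : ideal_gen f (f j).
Proof.
exists (fun i => (i == j)%:R); rewrite (bigD1 j) //= eqxx mulr1 big1 ?addr0 //.
by move=> i /negbTE ->; rewrite mulr0.
Qed.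

Lemma radicalD f p q : radical (ideal_gen f) p -> radical (ideal_gen f) q ->
  radical (ideal_gen f) (p + q).
Proof.
move=> [k hk] [l hl]; exists (k + l)%N; rewrite exprDn; apply: ideal_gen_sum => i _.
rewrite -mulr_natr; apply: ideal_genM; have [li|il] := leqP l i.
  by rewrite -{2}(subnK li) exprD mulrA mulrC; apply: ideal_genM.
have e : (k + l - i = k + (l - i))%N by rewrite addnBA // ltnW.
by rewrite e exprD -mulrA; apply: ideal_genM.
Qed.

End Primary.

Lemma irrelevantP (K : fieldType) N (p : {mpoly K[N.+1]}) : irrelevant p <-> p@_0%MM = 0.
Proof.
split=> [[g ->]|p0].
  rewrite raddf_sum big1 //= => i _; rewrite rmorphM /= mcoeffX.
  by rewrite -mdeg_eq0 mdeg1 mul0r.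
rewrite [p]mpolyE big_seq; apply: ideal_gen_sum => k kp.
have k0 : k != 0%MM by apply: contraTneq kp => ->; rewrite mcoeff_msupp p0 eqxx.
have [i ki] : exists i, k i != 0%N.
  apply/existsP; apply: contraNT k0; rewrite negb_exists => /forallP h.
  by apply/eqP/mnmP => i; rewrite mnm0E; apply/eqP; have := h i; rewrite negbK.
have uk : (U_(i) <= k)%MM.
  by apply/mnm_lepP => j; rewrite mnm1E; case: eqP => // <-; rewrite lt0n.
rewrite -mul_mpolyC -(submK uk) mpolyXD mulrA mulrC.
by apply: ideal_genM; apply: (ideal_gen_mem (fun i => 'X_i)).
Qed.

Lemma m_primary_powers (K : fieldType) N n d (f : 'I_n -> {mpoly K[N.+1]}) :
  (forall j, (f j)@_0%MM = 0) -> (forall i, exists j, f j = 'X_i ^+ d) ->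
  m_primary (ideal_gen f).
Proof.
move=> f0 fX.
have I0 p : ideal_gen f p -> p@_0%MM = 0.
  by move=> [g ->]; rewrite raddf_sum big1 //= => j _; rewrite rmorphM /= f0 mul0r.
have irr p : irrelevant p -> radical (ideal_gen f) p.
  move=> [g ->]; elim/big_ind: _ => [|p1 p2|i _].
  - by exists 1%N; rewrite expr1; apply: ideal_gen0.
  - exact: radicalD.
  - have [j fj] := fX i; exists d; rewrite exprMn -fj; apply: ideal_genM.
    exact: ideal_gen_mem.
split; last first.
  move=> p; split=> [[k /I0]|]; last exact: irr.
  rewrite rmorphXn /= => /eqP; rewrite expf_eq0 => /andP[_ /eqP h].
  exact/irrelevantP.
split=> [/I0|p q Ipq].
  by rewrite mcoeff1 eqxx => /eqP; rewrite oner_eq0.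
have [q0|q0] := eqVneq (q@_0%MM) 0; [right | left].
  by apply/irr/irrelevantP.
(* When the constant term [c] is nonzero, [c - q] is nilpotent modulo the ideal, so [q] is
   invertible there: [q] divides [c ^ k - (c - q) ^ k]. *)
pose c := q@_0%MM.
have [k hk] : radical (ideal_gen f) (c%:MP - q).
  by apply/irr/irrelevantP; rewrite mcoeffB mcoeffC eqxx mulr1 subrr.
have -> : p = (p * c%:MP ^+ k) * (c^-1 ^+ k)%:MP.
  by rewrite -mulrA -rmorphXn /= -rmorphM /= -exprMn divff // expr1n mulr1.
apply: ideal_genM.
have -> : p * c%:MP ^+ k = p * (c%:MP ^+ k - (c%:MP - q) ^+ k) + (c%:MP - q) ^+ k * p.
  by rewrite mulrBr [_ * p]mulrC subrK.
apply: ideal_genD; last exact: ideal_genM.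
by rewrite subrXX opprB addrC subrK mulrA; apply: ideal_genM.
Qed.

Section Family.
Variables (N d n : nat) (delta : nat) (s : seq (seq nat)).
Hypotheses (d0 : (0 < d)%N) (ss : size s = n) (bs : balanced delta N.+1 d s).
Hypothesis delta1 : (delta <= 1)%N.

Definition monomial_of (j : 'I_n) : 'X_{1..N.+1} :=
  [multinom nth 0%N (nth [::] s j) i | i < N.+1].

Let smem (j : 'I_n) : nth [::] s j \in s.
Proof. by rewrite mem_nth // ss. Qed.

Lemma monomial_of_inj : injective monomial_of.
Proof.
case: bs => us hs _ _ j j' /mnmP e.
have [h1 _] := hs _ (smem j); have [h2 _] := hs _ (smem j').
have js (i : 'I_n) : (i < size s)%N by rewrite ss.
apply/val_inj/eqP; rewrite -(nth_uniq [::] (js j) (js j') us); apply/eqP.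
apply: (eq_from_nth (x0 := 0%N)) => [|i]; rewrite h1 ?h2 // => iN.
by have := e (Ordinal iN); rewrite !mnmE.
Qed.

Lemma mdeg_monomial_of j : mdeg (monomial_of j) = d.
Proof.
case: bs => _ hs _ _; have [h1 <-] := hs _ (smem j).
rewrite mdegE sumnE (big_nth 0%N) h1 big_mkord.
by apply: eq_bigr => i _; rewrite mnmE.
Qed.

Lemma monomial_of_power i : exists j, monomial_of j = (U_(i) *+ d)%MM.
Proof.
case: bs => _ _ ps _; have [m ms e] := ps i (ltn_ord i).
have js : (index m s < n)%N by rewrite -ss index_mem.
have E : monomial_of (Ordinal js) i = d by rewrite mnmE nth_index.
exists (Ordinal js); have := mdeg_monomial_of (Ordinal js).
rewrite mdegE (bigD1 i) //= E => /eqP; rewrite -[X in _ == X]addn0 eqn_add2l sum_nat_eq0.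
move=> /forallP h; apply/mnmP => k; rewrite mulmnE mnm1E.
case: eqP => [<-|/eqP ik]; first by rewrite mul1n.
by have := h k; rewrite eq_sym ik => /eqP ->.
Qed.

Lemma balanced_monomial_of (C : {set 'I_n}) (g : 'I_N.+1 -> nat) :
  (1 < #|C| < n)%N -> (forall k i, k \in C -> g i <= monomial_of k i)%N ->
  (#|C|.-1 * d + delta <= (d - \sum_i g i) * n.-1)%N.
Proof.
move=> Cn gC; case: (bs) => us hs _ hb.
(* A common divisor of degree [d] would equal every member of [C], but [C] has two distinct ones. *)
have gd : (\sum_i g i < d)%N.
  have le k : k \in C -> (\sum_i g i <= d)%N.
    by move=> kC; rewrite -(mdeg_monomial_of k) mdegE; apply: leq_sum => i _; apply: gC.
  have [k [k' [kC k'C kk']]] : exists k k', [/\ k \in C, k' \in C & k != k'].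
    have /card_gt1P[k [k' h]] : (1 < #|C|)%N by lia.
    by exists k, k'.
  rewrite ltn_neqAle (le k kC) andbT; apply: contra_neq kk' => e.
  have E j i : j \in C -> monomial_of j i = g i.
    move=> jC; apply/eqP; rewrite eq_sym.
    have := leqif_sum (fun i (_ : true) => leqif_eq (gC j i jC)).
    rewrite -mdegE mdeg_monomial_of => -[_]; rewrite e eqxx.
    by move=> /esym/forallP/(_ i).
  by apply/monomial_of_inj/mnmP => i; rewrite !E.
(* For a trivial common divisor, which [balanced] does not test, [#|C| < n] and [delta <= d]
   suffice. *)
have [g0|g0] := posnP (\sum_i g i)%N.
  rewrite g0 subn0 [leqRHS]mulnC; apply: mulnD_leq; first by lia.
  exact: leq_trans delta1 d0.
pose gs := [seq g i | i <- enum 'I_N.+1].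
have gsz : size gs = N.+1 by rewrite size_map size_enum_ord.
have gsum : sumn gs = (\sum_i g i)%N by rewrite sumnE big_map big_enum.
have := hb gs gsz; rewrite gsum g0 gd ss => /(_ isT); apply: leq_trans.
rewrite leq_add2r leq_mul2r; apply/orP; right.
suff : (#|C| <= count (mdvd gs) s)%N by lia.
rewrite -sum1_card -sum1_count (big_nth [::]) big_mkord ss.
rewrite [X in (_ <= X)%N]big_mkcond [X in (X <= _)%N]big_mkcond /=; apply: leq_sum => j _.
case: ifP => // jC; rewrite ifT //.
have [hj _] := hs _ (smem j); rewrite /mdvd all2E gsz hj eqxx /=.
apply/(all_nthP (0%N, 0%N)) => i; rewrite size_zip gsz hj minnn => iN.
rewrite nth_zip ?gsz ?hj //= (nth_map ord0) ?size_enum_ord //.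
by have := gC j (nth ord0 (enum 'I_N.+1) i) jC; rewrite mnmE nth_enum_ord.
Qed.

End Family.

Section Criterion.
Variables (K : fieldType) (N d n : nat) (delta : nat) (s : seq (seq nat)).
Hypotheses (N0 : (0 < N)%N) (d0 : (0 < d)%N) (n0 : (0 < n)%N).
Hypotheses (ss : size s = n.+1) (bs : balanced delta N.+1 d s) (delta1 : (delta <= 1)%N).

Let m : 'I_n.+1 -> 'X_{1..N.+1} := monomial_of N s.
Let f (j : 'I_n.+1) : {mpoly K[N.+1]} := 'X_[m j].

Lemma monomials_homog j : f j \is d.-homog.
Proof. by rewrite dhomogX; apply/eqP; apply: (mdeg_monomial_of ss bs). Qed.

Lemma monomials_powers : exists kk : 'I_N.+1 -> 'I_n.+1, forall i, f (kk i) = 'X_i ^+ d.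
Proof.
have [kk hk] := fin_all_exists (monomial_of_power ss bs).
by exists kk => i; rewrite /f /m hk mpolyXn.
Qed.

Lemma m_primary_monomials : m_primary (ideal_gen f).
Proof.
apply: (m_primary_powers (d := d)).
  move=> j; rewrite mcoeffX -mdeg_eq0 (mdeg_monomial_of ss bs).
  by rewrite -[d]prednK.
by have [kk hk] := monomials_powers; move=> i; exists (kk i).
Qed.

Lemma slope_subsheaf (F : subsheaf K N (- d%:Z) n.+1) rF muF :
  subsheaf_of F (Syz d f) -> has_rank F rF -> (0 < rF < n)%N -> has_slope F muF ->
  exists r c : nat, [/\ (0 < r)%N, muF = - (c%:R / r%:R) & (r * d * n.+1 + delta <= c * n)%N].
Proof.
move=> FE [B hB] rFn [r [c [r0 hr hc ->]]].
have er : r = rF by have [B' hB'] := hr; apply: generic_basis_rank hB' hB.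
have rn : (r.+1 < n.+1)%N by lia.
have := c1_subsheaf_Syz (K := K) N0 r0 rn (mdeg_monomial_of ss bs) _ FE hr hc.
move=> /(_ delta (balanced_monomial_of d0 ss bs delta1)) h.
have c0 : c <= 0.
  rewrite -(@pmulr_lle0 _ n%:Z) //; by apply: le_trans h; rewrite lerDl.
have ck : c = - (absz c)%:Z by rewrite lez0_abs // opprK.
exists r, (absz c); split=> //; first by rewrite {1}ck rmorphN /= mulNr -pmulrn.
by move: h; rewrite {1}ck mulNr addrC subr_le0 -PoszM lez_nat.
Qed.

(** After clearing denominators the claim is [r d (n + 1) <= c n], strict when [delta > 0]. *)
Lemma slope_compare r c : (0 < r)%N -> (r * d * n.+1 + delta <= c * n)%N ->
  let muE := (- (n.+1 * d)%N%:Z)%:~R / n%:R : rat in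
  - (c%:R / r%:R) <= muE /\ ((0 < delta)%N -> - (c%:R / r%:R) < muE).
Proof.
move=> r0 h; have r0' : (0 : rat) < r%:R by rewrite ltr0n.
have n0' : (0 : rat) < n%:R by rewrite ltr0n.
rewrite /= rmorphN /= mulNr lerN2 ltrN2 -pmulrn.
rewrite ler_pdivlMr // ltr_pdivlMr // ![_ / _ * _]mulrAC ler_pdivrMr // ltr_pdivrMr //.
rewrite -!natrM ler_nat ltr_nat; split; first by lia.
by lia.
Qed.

Lemma semistable_monomials : semistable (Syz d f).
Proof.
have [kk hk] := monomials_powers.
exists n, ((- (n.+1 * d)%N%:Z)%:~R / n%:R); split.
- by eexists; apply: (generic_basis_Syz monomials_homog hk).
- exact: (has_slope_Syz monomials_homog hk n0).
move=> F rF muF FE hr rFn /(slope_subsheaf FE hr rFn)[r [c [r0 -> h]]].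
by have [] := slope_compare r0 h.
Qed.

Lemma stable_monomials : (0 < delta)%N -> stable (Syz d f).
Proof.
move=> dl; have [kk hk] := monomials_powers.
exists n, ((- (n.+1 * d)%N%:Z)%:~R / n%:R); split.
- by eexists; apply: (generic_basis_Syz monomials_homog hk).
- exact: (has_slope_Syz monomials_homog hk n0).
move=> F rF muF FE hr rFn /(slope_subsheaf FE hr rFn)[r [c [r0 -> h]]].
by have [_] := slope_compare r0 h; apply.
Qed.

End Criterion.

Theorem theorem3p9 (K : closedFieldType) :
  (forall N d n : nat,
      (2 <= N)%N -> (0 < d)%N -> (N, d, n) <> (2, 2, 5)%N ->
      (N.+1 <= n <= 'C(d + N, N))%N ->
      exists m : 'I_n -> 'X_{1..N.+1},
        [/\ injective m, forall j, mdeg (m j) = d,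
            m_primary (ideal_gen (fun j => 'X_[K, m j]))
          & stable (Syz d (fun j => 'X_[K, m j]))])
  /\
  (exists m : 'I_5 -> 'X_{1..3},
     [/\ injective m, forall j, mdeg (m j) = 2%N,
         m_primary (ideal_gen (fun j => 'X_[K, m j]))
       & semistable (Syz 2 (fun j => 'X_[K, m j]))]).
Proof.
split=> [N d [|n] N2 d0 ne hn|].
  by move: hn; rewrite ltn0.
- have [s [ss]] := exists_balanced N d n.+1 N2 d0 hn.
  have -> : ((N, d, n.+1) != (2, 2, 5)%N) = true by apply/eqP.
  move=> bs.
  have N0 : (0 < N)%N by apply: ltnW.
  have n0 : (0 < n)%N by case/andP: hn; lia.
  exists (monomial_of N s); split.
  + exact: monomial_of_inj ss bs.
  + exact: mdeg_monomial_of ss bs.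
  + exact: m_primary_monomials ss bs.
  + exact: stable_monomials ss bs _ _.
have bs := balanced_conics.
exists (monomial_of 2 [:: [:: 2; 0; 0]; [:: 0; 2; 0]; [:: 0; 0; 2]; [:: 1; 1; 0]; [:: 1; 0; 1]]%N).
split.
+ exact: monomial_of_inj bs.
+ exact: mdeg_monomial_of bs.
+ exact: m_primary_monomials bs.
+ exact: semistable_monomials bs _.
Qed.
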